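(* Let $G$ be a finitely generated group. The following are equivalent: (1) $G$ embeds in Thompson's group $V$ (i.e. there is an injective group homomorphism $G\to V$); (2) $G$ is CF-TR, i.e. $G$ admits a faithful context-free action.
   Context: Thompson's group $V$: let $\mathfrak C=\{0,1\}^{\infty}$ be the Cantor set, and for $a\in\{0,1\}^*$ let $[a]=\{a\eta:\eta\in\{0,1\}^\infty\}$. Given two partitions $\mathfrak C=[a_1]\sqcup\dots\sqcup[a_m]=[b_1]\sqcup\dots\sqcup[b_m]$, define a homeomorphism $g$ of $\mathfrak C$ by $a_j\eta\mapsto b_j\eta$ ($\eta\in\{0,1\}^\infty$, $j=1,\dots,m$). $V$ is the group of all homeomorphisms of this form (acting on the right). Inverse graphs: let $\mathcal A$ be a finite alphabet with an involution $a\mapsto a^{-1}$. An inverse $\mathcal A$-graph is a tuple $\Gamma=(V\Gamma,E,\iota,\tau,\lambda,\cdot^{-1})$ with vertex set $V\Gamma$, edge set $E$, initial and terminal maps $\iota,\tau:E\to V\Gamma$, labelling $\lambda:E\to\mathcal A$ and an involution $e\mapsto e^{-1}$ on $E$ with $e^{-1}\neq e$, $\iota(e^{-1})=\tau(e)$, $\tau(e^{-1})=\iota(e)$, $\lambda(e^{-1})=\lambda(e)^{-1}$; it is assumed deterministic and co-deterministic (for all $v\in V\Gamma$, $a\in\mathcal A$ there is at most one edge labelled $a$ starting at $v$, and at most one ending at $v$). For $x\in V\Gamma$ let $L(\Gamma,x)\subseteq\mathcal A^*$ be the set of words labelling a closed path from $x$ to $x$. A context-free graph is a connected inverse $\mathcal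 A$-graph $\Gamma$ such that the language $L(\Gamma,x)$ is context-free for all (equivalently, for one) $x\in V\Gamma$. Schreier graphs: for a group $G=\langle\mathcal A\rangle$ with $\mathcal A$ finite and symmetric, a right action of $G$ on a set $X$ and $\xi\in X$, $\mathrm{Sch}(\xi,G;\mathcal A)$ is the inverse $\mathcal A$-graph with vertex set the orbit $\xi\cdot G$ and an edge $x\to xa$ labelled $a$ for each $x\in\xi\cdot G$, $a\in\mathcal A$. Context-free action: the action of $G=\langle\mathcal A\rangle$ on $X$ is context-free if it has finitely many orbits and $\mathrm{Sch}(\xi,G;\mathcal A)$ is a context-free graph for every $\xi\in X$ (this does not depend on the choice of the finite generating set). *)

(* Defs.v *)
From HB Require Import structures.
From Stdlib Require Import Relation_Operators.
From mathcomp Require Import all_boot.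
From mathcomp Require Import boolp classical_sets.

Set Implicit Arguments.
Unset Strict Implicit.
Unset Printing Implicit Defensive.

Local Open Scope classical_set_scope.
Local Open Scope group_scope.

(** * Thompson's group V *)

Definition cantor := nat -> bool.

Definition prepend (a : seq bool) (eta : cantor) : cantor :=
  fun n => if (n < size a)%N then nth false a n else eta (n - size a)%N.

Definition cone (a : seq bool) : set cantor := range (prepend a).

Definition cone_partition (I : Type) (a : I -> seq bool) : Prop :=
  partition setT (fun j => cone (a j)) setT.

(** Such a map is automatically a homeomorphism of the Cantor set. *)
Definition is_thompson (g : cantor -> cantor) : Prop :=
  exists (m : nat) (a b : 'I_m -> seq bool),
    [/\ cone_partition a, cone_partition b &
        forall (j : 'I_m) (eta : cantor),
          g (prepend (a j) eta) = prepend (b j) eta].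

Record thompsonV := ThompsonV {
  thompson_fun :> cantor -> cantor;
  thompson_funP : `[< is_thompson thompson_fun >] }.

HB.instance Definition _ := [isSub for thompson_fun].
HB.instance Definition _ := [Choice of thompsonV by <:].

Lemma prepend_cat a b eta : prepend (a ++ b) eta = prepend a (prepend b eta).
Proof.
apply/funext => n; rewrite /prepend size_cat nth_cat.
case: (ltnP n (size a)) => h; first by rewrite ltn_addr.
by rewrite subnDA -(ltn_add2l (size a) (n - _)) subnKC.
Qed.

Lemma prepend_inj a : injective (prepend a).
Proof.
move=> x y /(congr1 (fun f => fun n => f (size a + n)%N)) h.
apply/funext => n; move: (congr1 (fun f => f n) h).
by rewrite /prepend ltnNge leq_addr /= addKn.
Qed.

Lemma prepend_size_inj a b x y : size a = size b ->
  prepend a x = prepend b y -> a = b.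
Proof.
move=> sz e; apply: (@eq_from_nth _ false) => // i hi.
by move: (congr1 (fun f => f i) e); rewrite /prepend -sz hi.
Qed.

Lemma prepend_take N (x : cantor) :
  x = prepend (mkseq x N) (fun n => x (N + n)%N).
Proof.
apply/funext => n; rewrite /prepend size_mkseq.
by case: ltnP => h; [rewrite nth_mkseq | rewrite subnKC].
Qed.

Lemma cone_partitionP (I : Type) (a : I -> seq bool) : cone_partition a <->
  (forall x, exists j eta, x = prepend (a j) eta) /\
  (forall i j x y, prepend (a i) x = prepend (a j) y -> i = j).
Proof.
split=> [[cov dis _]|[cov dis]].
  split=> [x|i j x y e].
    have : setT x by [].
    by rewrite -cov => -[j _ [eta _ <-]]; exists j, eta.
  apply: (dis i j Logic.I Logic.I) => //; exists (prepend (a i) x); split.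
    by exists x.
  by exists y.
split.
- rewrite eqEsubset; split=> // x _.
  by have [j [eta ->]] := cov x; exists j => //; exists eta.
- by move=> i j _ _ [_ [[x _ <-] [y _ e]]]; exact: dis (esym e).
- by move=> i _; exists (prepend (a i) (fun=> false)), (fun=> false).
Qed.

Lemma is_thompson_fin (I : finType) (a b : I -> seq bool) g :
  cone_partition a -> cone_partition b ->
  (forall j eta, g (prepend (a j) eta) = prepend (b j) eta) -> is_thompson g.
Proof.
have reidx (c : I -> seq bool) : cone_partition c ->
    cone_partition (fun k : 'I_#|I| => c (enum_val k)).
  move=> /cone_partitionP[cov dis]; apply/cone_partitionP; split=> [x|i j x y].
    have [j [eta ->]] := cov x.
    by exists (enum_rank j), eta; rewrite enum_rankK.
  by move/dis/enum_val_inj.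
move=> pa pb h; exists #|I|, (a \o enum_val), (b \o enum_val).
by split=> [||j eta]; [exact: reidx | exact: reidx | exact: h].
Qed.

Lemma is_thompson_id : is_thompson idfun.
Proof.
have p : cone_partition (fun _ : unit => [::]).
  apply/cone_partitionP; split=> [x|[] [] //].
  by exists tt, x; apply/funext => n; rewrite /prepend /= subn0.
exact: (is_thompson_fin p p).
Qed.

Lemma is_thompson_inv g : is_thompson g ->
  exists2 h, is_thompson h & cancel g h /\ cancel h g.
Proof.
move=> [m [a [b [pa pb gab]]]].
have /cone_partitionP[cova _] := pa; have /cone_partitionP[covb disb] := pb.
have /choice[h hP] : forall y, exists x, exists j eta,
    y = prepend (b j) eta /\ x = prepend (a j) eta.
  by move=> y; have [j [eta ->]] := covb y; exists (prepend (a j) eta), j, eta.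
have hba j eta : h (prepend (b j) eta) = prepend (a j) eta.
  have [k [z [e ->]]] := hP (prepend (b j) eta).
  have jk := disb _ _ _ _ e; rewrite -jk in e *.
  by rewrite (prepend_inj e).
exists h; first by exists m, b, a.
split=> x.
  by have [j [eta ->]] := cova x; rewrite gab hba.
by have [j [eta ->]] := covb x; rewrite hba gab.
Qed.

Lemma is_thompson_level g : is_thompson g -> exists N0, forall N, (N0 <= N)%N ->
  exists2 p : N.-tuple bool -> seq bool, cone_partition p &
    forall (w : N.-tuple bool) eta, g (prepend w eta) = prepend (p w) eta.
Proof.
move=> gV; have [h _ [gK hK]] := is_thompson_inv gV.
case: gV => [m [a [b [/cone_partitionP[cova _] _ gab]]]].
exists (\max_(j < m) size (a j)) => N leN.
have /choice[p pP] : forall w : N.-tuple bool, exists q, forall eta,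
    g (prepend w eta) = prepend q eta.
  move=> w; have [j [z e]] := cova (prepend w (fun=> false)).
  have szj : (size (a j) <= N)%N by apply: leq_trans leN; exact: leq_bigmax.
  have -> : tval w = a j ++ drop (size (a j)) w.
    rewrite -{1}(cat_take_drop (size (a j)) w); congr (_ ++ _).
    move: e; rewrite -{1}(cat_take_drop (size (a j)) w) prepend_cat.
    by apply: prepend_size_inj; rewrite size_takel // size_tuple.
  by exists (b j ++ drop (size (a j)) w) => eta; rewrite !prepend_cat gab.
exists p => //; apply/cone_partitionP; split=> [y|w w' x y].
  have sz : size (mkseq (h y) N) == N by rewrite size_mkseq.
  exists (Tuple sz), (fun n => h y (N + n)%N).
  by rewrite -pP /= -prepend_take hK.
rewrite -!pP => /(can_inj gK) e; apply: val_inj.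
by apply: prepend_size_inj e; rewrite !size_tuple.
Qed.

Lemma is_thompson_comp f g :
  is_thompson f -> is_thompson g -> is_thompson (g \o f).
Proof.
move=> /is_thompson_inv[h hV [fK hK]] gV.
have [N1 H1] := is_thompson_level hV; have [N2 H2] := is_thompson_level gV.
have [p pp hp] := H1 (maxn N1 N2) (leq_maxl _ _).
have [q pq gq] := H2 (maxn N1 N2) (leq_maxr _ _).
apply: (is_thompson_fin pp pq) => w eta.
by rewrite /= -hp hK gq.
Qed.

Definition thompson_one : thompsonV := ThompsonV (asboolT is_thompson_id).

(** V acts on the right: the product [f * g] is "first [f], then [g]". *)
Definition thompson_mul (f g : thompsonV) : thompsonV :=
  ThompsonV (asboolT
    (is_thompson_comp (asboolW (thompson_funP f)) (asboolW (thompson_funP g)))).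

Lemma thompson_inv_ex (f : thompsonV) :
  exists g : thompsonV, cancel f g /\ cancel g f.
Proof.
have [h hV hK] := is_thompson_inv (asboolW (thompson_funP f)).
by exists (ThompsonV (asboolT hV)).
Qed.

Definition thompson_inv (f : thompsonV) : thompsonV :=
  projT1 (cid (thompson_inv_ex f)).

Lemma thompson_mulA : associative thompson_mul.
Proof. by move=> f g h; apply: val_inj. Qed.

Lemma thompson_mul1 : left_id thompson_one thompson_mul.
Proof. by move=> f; apply: val_inj. Qed.

Lemma thompson_mulr1 : right_id thompson_one thompson_mul.
Proof. by move=> f; apply: val_inj. Qed.

Lemma thompson_mulV : left_inverse thompson_one thompson_inv thompson_mul.
Proof.
move=> f; apply: val_inj; apply/funext => x /=.
by rewrite /thompson_inv; case: cid => g [fK gK] /=; rewrite gK.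
Qed.

Lemma thompson_mulrV : right_inverse thompson_one thompson_inv thompson_mul.
Proof.
move=> f; apply: val_inj; apply/funext => x /=.
by rewrite /thompson_inv; case: cid => g [fK gK] /=; rewrite fK.
Qed.

HB.instance Definition _ := isGroup.Build thompsonV
  thompson_mulA thompson_mul1 thompson_mulr1 thompson_mulV thompson_mulrV.

Definition embeds (G H : groupType) : Prop :=
  exists phi : {multiplicative G -> H}, injective phi.

(** * Context-free languages *)

Record cfg (T : finType) := Cfg {
  nonterminal : finType;
  start : nonterminal;
  productions : seq (nonterminal * seq (nonterminal + T)) }.

Definition cfg_step (T : finType) (g : cfg T)
    (u v : seq (nonterminal g + T)) : Prop :=
  exists l r X rhs, [/\ (X, rhs) \in productions g,
    u = l ++ inl X :: r & v = l ++ rhs ++ r].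

Definition cfg_language (T : finType) (g : cfg T) : set (seq T) :=
  [set w | clos_refl_trans _ (@cfg_step T g) [:: inl (start g)] (map inr w)].

Definition context_free_language (T : finType) (L : set (seq T)) : Prop :=
  exists g : cfg T, L = cfg_language g.

(** * Inverse graphs *)

Record inv_alphabet := InvAlphabet {
  letter :> finType;
  linv : letter -> letter;
  linvK : involutive linv }.

Record inverse_graph (A : inv_alphabet) := InverseGraph {
  vertex : Type;
  edge : Type;
  src : edge -> vertex;
  tgt : edge -> vertex;
  lab : edge -> A;
  einv : edge -> edge;
  einvK : involutive einv;
  einv_neq : forall e, einv e <> e;
  src_einv : forall e, src (einv e) = tgt e;
  tgt_einv : forall e, tgt (einv e) = src e;
  lab_einv : forall e, lab (einv e) = linv (lab e);
  graph_det : forall e f, src e = src f -> lab e = lab f -> e = f;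
  graph_codet : forall e f, tgt e = tgt f -> lab e = lab f -> e = f }.

Section InverseGraphTheory.
Variables (A : inv_alphabet) (Gamma : inverse_graph A).

Fixpoint is_path (x : vertex Gamma) (p : seq (edge Gamma)) (y : vertex Gamma) :
    Prop :=
  if p is e :: p' then src e = x /\ is_path (tgt e) p' y else x = y.

Definition closed_path_language (x : vertex Gamma) : set (seq A) :=
  [set w | exists2 p, is_path x p x & w = map (@lab A Gamma) p].

Definition graph_connected : Prop :=
  forall x y : vertex Gamma, exists p, is_path x p y.

Definition context_free_graph : Prop :=
  graph_connected /\
  forall x : vertex Gamma, context_free_language (closed_path_language x).

End InverseGraphTheory.

(** * Schreier graphs and context-free actions *)

(** A finite symmetric generating set, as an alphabet of formal letters mapped
    to [G].  The involution on letters has no fixed point even when the image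
    of a letter is of order at most 2: otherwise a loop of a Schreier graph
    labelled by a self-inverse letter would be its own inverse edge.  As the
    alphabet is symmetric, products of letters give the whole subgroup it
    generates. *)
Record generating_system (G : groupType) := GeneratingSystem {
  gen_alphabet :> inv_alphabet;
  gen_eval : gen_alphabet -> G;
  gen_linv : forall a, gen_eval (linv a) = (gen_eval a)^-1;
  gen_linv_neq : forall a : gen_alphabet, linv a <> a;
  gen_generates : forall g : G,
    exists w : seq gen_alphabet, g = \prod_(a <- w) gen_eval a }.

Record right_action (G : groupType) (X : Type) := RightAction {
  act :> X -> G -> X;
  act1 : forall x, act x 1 = x;
  actM : forall x g h, act x (g * h) = act (act x g) h }.

Definition faithful_action (G : groupType) (X : Type) (to : right_action G X) :
    Prop :=
  forall g : G, (forall x, to x g = x) -> g = 1.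

Definition orbit_set (G : groupType) (X : Type) (to : right_action G X)
    (xi : X) : set X := range (to xi).

Definition finitely_many_orbits (G : groupType) (X : Type)
    (to : right_action G X) : Prop :=
  exists (n : nat) (r : 'I_n -> X), \bigcup_i orbit_set to (r i) = setT.

Section Schreier.
Variables (G : groupType) (S : generating_system G).
Variables (X : Type) (to : right_action G X) (xi : X).

Definition sch_vertex := {x : X | orbit_set to xi x}.

Definition sch_edge := (sch_vertex * S)%type.

Lemma sch_tgt_subproof (e : sch_edge) :
  orbit_set to xi (to (sval e.1) (gen_eval e.2)).
Proof.
case: e => [[x [g hg e]] a]; exists (g * gen_eval a) => //=.
by rewrite actM e.
Qed.

Definition sch_tgt (e : sch_edge) : sch_vertex :=
  exist _ (to (sval e.1) (gen_eval e.2)) (sch_tgt_subproof e).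

Definition sch_einv (e : sch_edge) : sch_edge := (sch_tgt e, linv e.2).

Lemma sch_vertex_inj (x y : sch_vertex) : sval x = sval y -> x = y.
Proof. by case: x y => [x hx] [y hy] /= e; exact: eq_exist. Qed.

Lemma sch_tgt_einv e : sch_tgt (sch_einv e) = e.1.
Proof. by apply: sch_vertex_inj; rewrite /= gen_linv -actM mulgV act1. Qed.

Lemma sch_einvK : involutive sch_einv.
Proof.
move=> e; rewrite {1}/sch_einv sch_tgt_einv /= linvK.
by case: e.
Qed.

Lemma sch_einv_neq e : sch_einv e <> e.
Proof. by move=> /(congr1 snd) /=; exact: gen_linv_neq. Qed.

Lemma sch_det (e f : sch_edge) : e.1 = f.1 -> e.2 = f.2 -> e = f.
Proof. by case: e f => [x a] [y b] /= -> ->. Qed.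

Lemma sch_codet (e f : sch_edge) : sch_tgt e = sch_tgt f -> e.2 = f.2 -> e = f.
Proof.
move=> et el; apply: (can_inj sch_einvK).
by rewrite /sch_einv et el.
Qed.

Definition Sch : inverse_graph S := @InverseGraph S sch_vertex sch_edge
  fst sch_tgt snd sch_einv sch_einvK sch_einv_neq
  (fun=> erefl) sch_tgt_einv (fun=> erefl) sch_det sch_codet.

End Schreier.

Definition context_free_action (G : groupType) (S : generating_system G)
    (X : Type) (to : right_action G X) : Prop :=
  finitely_many_orbits to /\
  forall xi : X, context_free_graph (Sch S to xi).

Definition CF_TR (G : groupType) (S : generating_system G) : Prop :=
  exists (X : Type) (to : right_action G X),
    faithful_action to /\ context_free_action S to.

(* Main.v *)
From HB Require Import structures.
From Stdlib Require Import Relation_Operators.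
From mathcomp Require Import all_boot zify.
From mathcomp Require Import boolp classical_sets.
Require Import Defs.

Set Implicit Arguments.
Unset Strict Implicit.
Unset Printing Implicit Defensive.

(** From [V] to a context-free action: on a sufficiently long prefix, a generator
    of [G] acts on the Cantor set by rewriting it.  Points [p t t t ...] are
    configurations of a pushdown automaton, and the words fixing such a point are
    the runs of a prefix rewriting system from a word to itself, a context-free
    language.  Finitely many such orbits suffice for faithfulness: along any run
    the stack can be cut at the level where it is lowest, so that the
    motion of any cone is copied on the orbit of a short point.

    From a context-free action to [V]: let [lev x] be the distance of [x] to the
    root of its orbit.  In a derivation tree of a word labelling a closed path,
    each nonterminal is a chord of the path, and the words it derives all lead
    from one end of the chord to the other.  Cutting the path along chords shows
    that the frontiers of the ends (the components of [lev x >= m]) have bounded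
    diameter, and that an end is determined up to isomorphism by the chords near
    its frontier; so there are finitely many types of ends (Muller--Schupp).
    Recording the ends that contain a vertex, deepest first, encodes vertices by
    words over a finite alphabet on which generators rewrite a prefix of length 2.
    A state-dependent prefix code turns this into an action on the Cantor set by
    elements of [V]. *)

(** * Context-free grammars and prefix rewriting *)

Section Yield.
Variables (T : finType) (g : cfg T).
Implicit Types (f : seq (nonterminal g + T)) (w : seq T).

(** Derivation trees in big-step form, the roots of a forest being parsed from left to right: an
    induction descends into a node and then continues with its right siblings. *)
Inductive yields : seq (nonterminal g + T) -> seq T -> Prop :=
| yields_nil : yields [::] [::]
| yields_letter a f w : yields f w -> yields (inr a :: f) (a :: w)
| yields_rule X rhs u f w : (X, rhs) \in productions g ->
    yields rhs u -> yields f w -> yields (inl X :: f) (u ++ w).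

Lemma yields_cat f1 f2 w1 w2 :
  yields f1 w1 -> yields f2 w2 -> yields (f1 ++ f2) (w1 ++ w2).
Proof.
move=> h h2; elim: h => {f1 w1} //= [a f w _ ih|X rhs u f w hX hu _ _ ih].
  exact: yields_letter.
by rewrite -catA; apply: yields_rule hX hu ih.
Qed.

Lemma yields_nilE w : yields [::] w -> w = [::].
Proof. by move=> h; inversion h. Qed.

Lemma yields_consE x f w : yields (x :: f) w ->
  exists u v, [/\ w = u ++ v, yields [:: x] u & yields f v].
Proof.
move=> h; inversion h as [|a f' w' hf|X rhs u f' w' hX hu hf]; subst.
  by exists [:: a], w'; split=> //; apply: yields_letter; constructor.
exists u, w'; split=> //.
by rewrite -(cats0 u); apply: yields_rule hX hu yields_nil.
Qed.

Lemma yields_catE f1 f2 w : yields (f1 ++ f2) w ->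
  exists w1 w2, [/\ w = w1 ++ w2, yields f1 w1 & yields f2 w2].
Proof.
elim: f1 w => [|x f1 ih] w /=.
  by move=> h; exists [::], w; split=> //; constructor.
move=> /yields_consE[u [v [-> hx /ih[w1 [w2 [-> h1 h2]]]]]].
exists (u ++ w1), w2; split=> //; first by rewrite catA.
by rewrite -cat1s; apply: yields_cat.
Qed.

Lemma yields_terminals w : yields (map inr w) w.
Proof. by elim: w => [|a w ih] /=; constructor. Qed.

Let derives := clos_refl_trans _ (@cfg_step T g).

Lemma derives_ctx l r f f' : derives f f' -> derives (l ++ f ++ r) (l ++ f' ++ r).
Proof.
elim=> [u v [l' [r' [X [rhs [h -> ->]]]]]|u|u v w _ h1 _ h2].
- apply: rt_step; exists (l ++ l'), (r' ++ r), X, rhs.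
  by rewrite -!catA /= -?catA.
- exact: rt_refl.
- exact: rt_trans h1 h2.
Qed.

Lemma yields_derives f w : yields f w -> derives f (map inr w).
Proof.
elim=> {f w} [|a f w _ ih|X rhs u f w hX _ ihu _ ihw] /=.
- exact: rt_refl.
- by have := derives_ctx [:: inr a] [::] ih; rewrite /= !cats0.
- apply: (@rt_trans _ _ _ (rhs ++ f)).
    by apply: rt_step; exists [::], f, X, rhs.
  rewrite map_cat; apply: (@rt_trans _ _ _ (map inr u ++ f)).
    exact: (derives_ctx [::] f ihu).
  by have := derives_ctx (map inr u) [::] ihw; rewrite !cats0.
Qed.

Lemma derives_yields f f' w : derives f f' -> yields f' w -> yields f w.
Proof.
move=> h; elim: h w => [u v [l [r [X [rhs [hX -> ->]]]]]|//|u v z _ h1 _ h2] w.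
  move=> /yields_catE[w1 [w2 [-> h1 /yields_catE[w3 [w4 [-> h3 h4]]]]]].
  by apply: yields_cat => //; apply: yields_rule hX h3 h4.
by move=> /h2 /h1.
Qed.

Lemma cfg_languageE w : cfg_language g w <-> yields [:: inl (start g)] w.
Proof.
split=> [h|/yields_derives //].
exact: derives_yields h (yields_terminals w).
Qed.

End Yield.

Local Open Scope classical_set_scope.

(** * Grammars made of all short rules that are sound for given languages *)

Section SoundGrammar.
Variables (T N : finType) (lang : N -> set (seq T)) (s0 : N).

Fixpoint form_lang (f : seq (N + T)) : set (seq T) :=
  match f with
  | [::] => [set [::]]
  | inr a :: f' => [set w | exists2 w', form_lang f' w' & w = a :: w']
  | inl X :: f' =>
      [set w | exists u v, [/\ lang X u, form_lang f' v & w = u ++ v]]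
  end.

(* All productions with a short right-hand side that the intended languages [lang]
   satisfy: soundness is then automatic. *)
Definition sound_productions : seq (N * seq (N + T)) :=
  [seq p <- [seq (X, bseqval f) | X <- enum N, f <- enum {: 2.-bseq (N + T)}]
  | `[< form_lang p.2 `<=` lang p.1 >]].

Lemma mem_sound_productions X f :
  (X, f) \in sound_productions <-> (size f <= 2)%N /\ form_lang f `<=` lang X.
Proof.
rewrite mem_filter; split=> [/andP[/asboolP h /allpairsP[[Y p] [_ _ [_ ef]]]]|].
  by split=> //; rewrite ef; apply: size_bseq.
move=> [sz h]; apply/andP; split; first exact/asboolP.
apply/allpairsP; exists (X, Bseq sz).
by split=> //; rewrite mem_enum.
Qed.

Definition sound_cfg : cfg T := Cfg s0 sound_productions.

Lemma sound_cfg_sound f w : @yields _ sound_cfg f w -> form_lang f w.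
Proof.
elim=> {f w} [//|a f w _ ih|X rhs u f w hX _ ihu _ ihw] /=; first by exists w.
by move/mem_sound_productions: hX => [_ h]; exists u, w; split=> //; apply: h.
Qed.

(** A rule may be used as soon as the semantic inclusion holds, so completeness proofs never have to
    list productions. *)
Lemma sound_cfg_yields X rhs w : (size rhs <= 2)%N ->
  form_lang rhs `<=` lang X -> @yields _ sound_cfg rhs w ->
  @yields _ sound_cfg [:: inl X] w.
Proof.
move=> sz h hw; rewrite -(cats0 w).
by apply: (@yields_rule _ sound_cfg X rhs) hw (yields_nil _); apply/mem_sound_productions.
Qed.

End SoundGrammar.

(** * Prefix rewriting systems and the languages of their runs *)

Section PrefixRewriting.
Variables (C A : Type) (R : set (seq C * A * seq C)).

(** Words are stacks with their top on the left; there is no state apart from the stack. *)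
Inductive run : seq C -> seq A -> seq C -> Prop :=
| run_nil u : run u [::] u
| run_cons al a be x s v : R (al, a, be) ->
    run (be ++ x) s v -> run (al ++ x) (a :: s) v.

Lemma run_cat u s v s' w : run u s v -> run v s' w -> run u (s ++ s') w.
Proof.
by move=> h h'; elim: h h' => //= {u v}[al a be x {}s v hR _ ih /ih]; apply: run_cons.
Qed.

Lemma run_suffix u s v x : run u s v -> run (u ++ x) s (v ++ x).
Proof.
elim=> {u s v} [u|al a be y s v hR _ ih]; first exact: run_nil.
by rewrite -catA; apply: run_cons hR _; rewrite catA.
Qed.

Lemma run_nilE u v : run u [::] v -> u = v.
Proof. by move=> h; inversion h. Qed.

Lemma run_consE u a s v : run u (a :: s) v -> exists al be x,
  [/\ R (al, a, be), u = al ++ x & run (be ++ x) s v].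
Proof. by move=> h; inversion h as [|al a' be x s' v' hR h']; subst; exists al, be, x. Qed.

Variable M : nat.
Hypothesis RM : forall al a be, R (al, a, be) -> (size al <= M)%N /\ (size be <= M)%N.

Lemma long_suffix (al x : seq C) : (size al <= M)%N -> (M < size (al ++ x))%N ->
  exists x' c, x = rcons x' c.
Proof.
case: (lastP x) => [|x' c]; last by exists x', c.
by rewrite cats0 leqNgt => /negP.
Qed.

Definition run_pop u s v := exists u' v' c,
  [/\ u = rcons u' c, v = rcons v' c & run u' s v'].

Definition run_split u s v := exists s1 s2 w,
  [/\ s = s1 ++ s2, s2 <> [::], run u s1 w, run w s2 v & (size w <= M)%N].

(** While a stack has more than [M] letters, no rule reaches its last one. So either this letter
    survives to the end, or the stack comes down to [M] letters with a step still to go. *)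
Lemma run_long u s v : run u s v -> (M < size u)%N ->
  run_pop u s v \/ run_split u s v.
Proof.
elim=> {u s v} [u|al a be x s v hR hs ih] lu.
  case: (lastP u) lu => // u' c _; left; exists u', u', c; split=> //.
  exact: run_nil.
have [alM _] := RM hR.
have [x' [c ex]] := long_suffix alM lu.
case: s hs ih => [|b s] hs ih.
  left; exists (al ++ x'), (be ++ x'), c.
  rewrite -(run_nilE hs) ex !rcons_cat; split=> //.
  exact: run_cons hR (run_nil _).
case: (ltnP M (size (be ++ x))) => [lw|lw].
  case: (ih lw) => [[u' [v' [c' [e1 -> h']]]]|[s1 [s2 [w [-> n2 h1 h2 lw']]]]].
    move: e1; rewrite ex -rcons_cat => /rcons_inj[e1 e2].
    left; exists (al ++ x'), v', c; rewrite e2 rcons_cat; split=> //.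
    by apply: run_cons hR _; rewrite e1.
  right; exists (a :: s1), s2, w; split=> //.
  exact: run_cons hR h1.
right; exists [:: a], (b :: s), (be ++ x); split=> //.
exact: run_cons hR (run_nil _).
Qed.

(** The first step is split off by hand, so that both factors are nonempty and hence shorter than
    the word. *)
Lemma run_decompose u a b s v : run u (a :: b :: s) v ->
  run_pop u (a :: b :: s) v \/
  exists s1 s2 w, [/\ a :: b :: s = s1 ++ s2, s1 <> [::], s2 <> [::],
    run u s1 w /\ run w s2 v & (size w <= M)%N].
Proof.
move=> /run_consE[al [be [x [hR -> h]]]].
case: (leqP (size (be ++ x)) M) => lw.
  right; exists [:: a], (b :: s), (be ++ x); split=> //; split=> //.
  exact: run_cons hR (run_nil _).
case: (run_long h lw) => [[u' [v' [c [e -> h']]]]|[s1 [s2 [w [-> n2 h1 h2 lw']]]]].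
  have [_ beM] := RM hR; have [x' [c' ex]] := long_suffix beM lw.
  move: e; rewrite ex -rcons_cat => /rcons_inj[e1 e2].
  left; exists (al ++ x'), v', c; rewrite e2 rcons_cat; split=> //.
  by apply: run_cons hR _; rewrite e1.
right; exists (a :: s1), s2, w; split=> //; split=> //.
exact: run_cons hR h1.
Qed.

End PrefixRewriting.

(** The nonterminals are pairs of words of length at most [M], standing for the runs from one to the
    other. A run of at least two steps comes from a run on shorter stacks or from two shorter runs
    meeting at a short stack. *)
Lemma run_context_free (C A : finType) (R : set (seq C * A * seq C)) (M : nat)
    (u0 v0 : seq C) :
  (forall al a be, R (al, a, be) -> (size al <= M)%N /\ (size be <= M)%N) ->
  (size u0 <= M)%N -> (size v0 <= M)%N ->
  context_free_language [set s | run R u0 s v0].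
Proof.
move=> RM hu0 hv0.
pose N := (M.-bseq C * M.-bseq C)%type.
pose lang (X : N) : set (seq A) := [set s | run R X.1 s X.2].
pose g := sound_cfg lang (Bseq hu0, Bseq hv0); exists g.
apply/seteqP; split=> s /=; last first.
  move/cfg_languageE/sound_cfg_sound => /= -[u [v [hu -> ->]]].
  by rewrite cats0.
move=> hs; apply/cfg_languageE => /=.
suff main n : forall s, (size s <= n)%N -> forall (u v : M.-bseq C),
    run R u s v -> @yields _ g [:: inl (u, v)] s.
  exact: (main _ s (leqnn _)).
elim: n => [|n ih] {hs}s.
  rewrite leqn0 => /nilP-> u v /run_nilE e.
  apply: (@sound_cfg_yields _ _ _ _ _ [::]) => //; last by constructor.
  by move=> w /= ->; rewrite /lang /= e; apply: run_nil.
(* Popping a letter shortens the stack but not the word, hence an inner induction on [size u]. *)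
move=> sz u; have [m] := ubnP (size u).
elim: m u => // m ihm u hm v; case: s sz ihm => [|a [|b s]] sz ihm hs.
- exact: ih.
- apply: (@sound_cfg_yields _ _ _ _ _ [:: inr a]) => //.
    by move=> w /= [w' -> ->].
  exact: (yields_terminals g [:: a]).
case: (run_decompose RM hs) => [[u' [v' [c [eu ev h]]]]|].
  have lu : (size u' <= M)%N by have := size_bseq u; rewrite eu size_rcons => /ltnW.
  have lv : (size v' <= M)%N by have := size_bseq v; rewrite ev size_rcons => /ltnW.
  apply: (@sound_cfg_yields _ _ _ _ _ [:: inl (Bseq lu, Bseq lv)]) => //.
    move=> w /= [w1 [_ [hw -> ->]]]; rewrite cats0 /lang /= eu ev -!cats1.
    exact: run_suffix.
  by apply: ihm => //=; move: hm; rewrite eu size_rcons.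
move=> [s1 [s2 [w [e n1 n2 [h1 h2] lw]]]].
have [l1 l2] : (size s1 <= n)%N /\ (size s2 <= n)%N.
  move: (congr1 size e) sz; rewrite size_cat.
  by case: s1 n1 {e h1} => // ? ? _; case: s2 n2 {h2} => //= ? ? _; lia.
apply: (@sound_cfg_yields _ _ _ _ _ [:: inl (u, Bseq lw); inl (Bseq lw, v)]) => //.
  move=> t /= [w1 [_ [hw1 [w2 [_ [hw2 -> ->]]] ->]]].
  by rewrite cats0; apply: run_cat hw1 hw2.
rewrite e -cat1s; apply: yields_cat; first exact: ih.
exact: ih.
Qed.

(** * Codes for groups acting by prefix rewriting *)

Local Open Scope group_scope.

Lemma catr_inj (T : Type) (r : seq T) : injective (cat^~ r).
Proof.
move=> a b /(congr1 rev); rewrite !rev_cat => /(congr1 (drop (size (rev r)))).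
by rewrite !drop_size_cat // => /(can_inj revK).
Qed.

Lemma prepend_nil eta : prepend [::] eta = eta.
Proof. by apply/funext => n; rewrite /prepend /= subn0. Qed.

Lemma prepend_comparable u v x y : (size u <= size v)%N ->
  prepend u x = prepend v y -> exists2 d, v = u ++ d & x = prepend d y.
Proof.
move=> sz e; have ev := cat_take_drop (size u) v.
move: e; rewrite -{1}ev prepend_cat => e.
have eu : u = take (size u) v by apply: prepend_size_inj e; rewrite size_takel.
exists (drop (size u) v); first by rewrite {1}eu.
by move: e; rewrite -eu; apply: prepend_inj.
Qed.

(** The cones of the words of length [N] form a partition, and a bijection carries it to a second
    one. *)
Lemma bijective_is_thompson (g h : cantor -> cantor) N :
  cancel g h -> cancel h g ->
  (forall w, size w = N -> exists w', forall eta,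
     g (prepend w eta) = prepend w' eta) ->
  is_thompson g.
Proof.
move=> gK hK loc.
have /choice[p pP] : forall w : N.-tuple bool, exists w', forall eta,
    g (prepend w eta) = prepend w' eta by move=> w; apply: loc; rewrite size_tuple.
have cov (x : cantor) : exists (w : N.-tuple bool) eta, x = prepend w eta.
  have sz : size (mkseq x N) == N by rewrite size_mkseq.
  by exists (Tuple sz), (fun n => x (N + n)%N); rewrite /= -prepend_take.
have dis (w w' : N.-tuple bool) x y : prepend w x = prepend w' y -> w = w'.
  by move=> e; apply: val_inj; apply: prepend_size_inj e; rewrite !size_tuple.
apply: (@is_thompson_fin _ (@tval N bool) p).
- by apply/cone_partitionP; split.
- apply/cone_partitionP; split=> [y|w w' x y].
    by have [w [eta e]] := cov (h y); exists w, eta; rewrite -pP -e hK.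
  by rewrite -!pP => /(can_inj gK); apply: dis.
- exact: pP.
Qed.

Lemma embeds_thompson (G : groupType) (f : G -> cantor -> cantor) :
  (forall g, is_thompson (f g)) -> (forall g h, f (g * h) = f h \o f g) ->
  injective f -> embeds G thompsonV.
Proof.
move=> fT fM fI.
pose phi g := ThompsonV (asboolT (fT g)).
have phiM : {morph phi : g h / g * h} by move=> g h; apply: val_inj; rewrite /= fM.
pose m := isMultiplicative.Build G thompsonV phi phiM.
pose Phi : {multiplicative G -> thompsonV} := HB.pack phi m.
by exists Phi => g h /(congr1 val) /fI.
Qed.

(* The complete prefix code [0, 10, 110, ..., 1...10, 1...1] with [k] words. *)
Fixpoint comb (k i : nat) : seq bool :=
  if k is k1.+1 then
    if k1 is _.+1 then
      if i is i'.+1 then true :: comb k1 i' else [:: false]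
    else [::]
  else [::].

Lemma size_comb k i : (size (comb k i) <= k)%N.
Proof. by elim: k i => // -[|k] ih [|i] //; apply: ih. Qed.

Lemma cantor_cons (x : cantor) : x = prepend [:: x 0] (x \o succn).
Proof. by rewrite {1}(prepend_take 1 x). Qed.

Lemma comb_cover k x : (0 < k)%N ->
  exists2 i, (i < k)%N & exists y, x = prepend (comb k i) y.
Proof.
elim: k x => // -[|k] ih x _; first by exists 0 => //; exists x; rewrite prepend_nil.
rewrite (cantor_cons x); case: (x 0); last by exists 0 => //; exists (x \o succn).
have [i ik [y ->]] := ih (x \o succn) isT.
by exists i.+1 => //; exists y; rewrite -prepend_cat.
Qed.

Lemma comb_inj k i j x y : (i < k)%N -> (j < k)%N ->
  prepend (comb k i) x = prepend (comb k j) y -> i = j.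
Proof.
elim: k i j => // -[|k] ih [|i] [|j] //= hi hj e.
- by move: (congr1 (fun f => f 0) e).
- by move: (congr1 (fun f => f 0) e).
congr succn; apply: ih => //.
by apply: (@prepend_inj [:: true]); rewrite -!prepend_cat.
Qed.

(** * The action on the Cantor set induced by an action that rewrites prefixes *)

Section StackAction.
Variables (G : groupType) (S : generating_system G) (X : Type).
Variables (to : right_action G X) (T : eqType) (enc : X -> seq T) (l : seq T).
Hypothesis encl : forall x, all (mem l) (enc x).
Hypothesis enc_prefix : forall x y r, enc x = enc y ++ r -> x = y.

Definition rewrites g ga ga' :=
  forall x r, enc x = ga ++ r -> enc (to x g) = ga' ++ r.

Definition locally_rewrites g :=
  exists N, forall ga, size ga = N -> exists ga', rewrites g ga ga'.

Hypothesis gen_rewrites : forall a : S, locally_rewrites (gen_eval a).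

(** The live words form a tree whose leaves are the terminal words. *)
Definition live ga := exists x r, enc x = ga ++ r.
Definition terminal ga := exists x, enc x = ga.

Lemma enc_eq_cat x r : enc x = enc x ++ r -> r = [::].
Proof.
by move/(congr1 size); rewrite size_cat; case: r => //= *; lia.
Qed.

Definition kids ga := [seq c <- undup l | `[< live (rcons ga c) >]].

Lemma mem_kids ga c : (c \in kids ga) <-> live (rcons ga c).
Proof.
rewrite mem_filter; split=> [/andP[/asboolP //]|h]; apply/andP; split.
  exact/asboolP.
case: h => x [r e]; rewrite mem_undup; apply: (allP (encl x)).
by rewrite e mem_cat mem_rcons in_cons eqxx.
Qed.

Lemma live_catl ga d : live (ga ++ d) -> live ga.
Proof. by move=> [x [r]]; rewrite -catA => e; exists x, (d ++ r). Qed.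

Lemma live_kids ga : live ga -> kids ga = [::] -> terminal ga.
Proof.
move=> [x [[|c r] e]] hk; first by exists x; rewrite e cats0.
have : c \in kids ga by apply/mem_kids; exists x, r; rewrite cat_rcons.
by rewrite hk.
Qed.

(** Each node uses the complete prefix code on its children, so every bit sequence can be decoded;
    the edge to an only child costs no bit. *)
Fixpoint codefrom ga d : seq bool :=
  if d is c :: d' then
    comb (size (kids ga)) (index c (kids ga)) ++ codefrom (rcons ga c) d'
  else [::].

Definition code := codefrom [::].

Lemma codefrom_cat ga d e :
  codefrom ga (d ++ e) = codefrom ga d ++ codefrom (ga ++ d) e.
Proof.
elim: d ga => [|c d ih] ga /=; first by rewrite cats0.
by rewrite ih catA cat_rcons.
Qed.

Lemma size_codefrom ga d : (size (codefrom ga d) <= size d * size l)%N.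
Proof.
elim: d ga => //= c d ih ga; rewrite size_cat mulSn leq_add ?ih //.
apply: leq_trans (size_comb _ _) _; rewrite size_filter.
by apply: leq_trans (count_size _ _) _; apply: size_undup.
Qed.

Lemma codefrom_comparable be ga ga' x y : live (be ++ ga) -> live (be ++ ga') ->
  prepend (codefrom be ga) x = prepend (codefrom be ga') y ->
  exists d, ga' = ga ++ d \/ ga = ga' ++ d.
Proof.
elim: ga be ga' => [|c ga ih] be [|c' ga'] hga hga' e.
- by exists [::]; left.
- by exists (c' :: ga'); left.
- by exists (c :: ga); right.
have ck : c \in kids be by apply/mem_kids; move: hga; rewrite -cat_rcons => /live_catl.
have ck' : c' \in kids be.
  by apply/mem_kids; move: hga'; rewrite -cat_rcons => /live_catl.
have cc' : c = c'.
  move: e; rewrite /= !prepend_cat => /comb_inj; rewrite !index_mem => /(_ ck ck').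
  by move/(congr1 (nth c (kids be))); rewrite !nth_index.
subst c'; move: e; rewrite /= !prepend_cat => /prepend_inj e.
have [||d h] := ih (rcons be c) ga' _ _ e; rewrite ?cat_rcons //.
by exists d; case: h => ->; [left|right].
Qed.

Lemma code_comparable ga ga' x y : live ga -> live ga' ->
  prepend (code ga) x = prepend (code ga') y ->
  exists d, ga' = ga ++ d \/ ga = ga' ++ d.
Proof. exact: (@codefrom_comparable [::]). Qed.

(** A leaf counts as arbitrarily deep: the bits after its code are carried along unchanged. *)
Definition deep N ga := (N <= size ga)%N \/ terminal ga.

Lemma parse N (x : cantor) : live [::] ->
  exists ga eta, [/\ live ga, deep N ga, (size ga <= N)%N & x = prepend (code ga) eta].
Proof.
move=> l0; elim: N => [|N [ga [eta [lga dga sga ->]]]].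
  exists [::], x; split=> //; first by left.
  by rewrite prepend_nil.
case: (boolP (nilp (kids ga))) => [/nilP/(live_kids lga) tga|kga].
  by exists ga, eta; split=> //; [right | apply: leqW].
case: dga => [dga|tga]; last by exists ga, eta; split=> //; [right | apply: leqW].
have [|i ik [y ->]] := @comb_cover (size (kids ga)) eta; first by rewrite lt0n.
have {dga}sga : size ga = N by apply/eqP; rewrite eqn_leq sga.
have c0 : T by case: (kids ga) kga.
pose c := nth c0 (kids ga) i.
have ck : c \in kids ga by apply: mem_nth.
exists (rcons ga c), y; split.
- exact/mem_kids.
- by left; rewrite size_rcons sga.
- by rewrite size_rcons sga.
have uk : uniq (kids ga) by rewrite filter_uniq // undup_uniq.
by rewrite -cats1 /code codefrom_cat prepend_cat /= cats0 index_uniq.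
Qed.

Lemma locally_rewrites1 : locally_rewrites 1.
Proof. by exists 0 => ga _; exists ga => x r; rewrite act1. Qed.

Lemma locally_rewritesM g h :
  locally_rewrites g -> locally_rewrites h -> locally_rewrites (g * h).
Proof.
move=> [N gN] [N' hN]; exists (N + N')%N => ga sga.
have [|ga1 h1] := gN (take N ga); first by rewrite size_takel // sga leq_addr.
pose d := ga1 ++ drop N ga.
have sd : (N' <= size d)%N by rewrite size_cat size_drop sga; lia.
have [|ga2 h2] := hN (take N' d); first by rewrite size_takel.
exists (ga2 ++ drop N' d) => x r e; rewrite actM -catA; apply: h2.
by rewrite catA cat_take_drop -catA; apply: h1; rewrite catA cat_take_drop.
Qed.

Lemma locally_rewritesT g : locally_rewrites g.
Proof.
have [w ->] := gen_generates S g; elim: w => [|a w ih].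
  by rewrite big_nil; apply: locally_rewrites1.
by rewrite big_cons; apply: locally_rewritesM => //; apply: gen_rewrites.
Qed.

(** Rewriting is required in both directions, so that the subtrees below [ga] and [ga'] coincide and
    share their codes. *)
Definition moves g ga ga' :=
  [/\ live ga, rewrites g ga ga' & rewrites g^-1 ga' ga].

Lemma actK g x : to (to x g) g^-1 = x.
Proof. by rewrite -actM mulgV act1. Qed.

Lemma moves_live g ga ga' : moves g ga ga' -> live ga'.
Proof. by move=> [[x [r e]] h _]; exists (to x g), r; apply: h. Qed.

Lemma moves_terminal g x : moves g (enc x) (enc (to x g)).
Proof.
split=> [|y r e|y r e]; first by exists x, [::]; rewrite cats0.
- by have yx := enc_prefix e; rewrite yx in e *; rewrite (enc_eq_cat e) cats0.
- have yx := enc_prefix e; rewrite yx in e *.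
  by rewrite (enc_eq_cat e) cats0 actK.
Qed.

Lemma moves_cat g ga ga' d : live (ga ++ d) -> moves g ga ga' ->
  moves g (ga ++ d) (ga' ++ d).
Proof. by move=> hl [_ h h']; split=> // x r; rewrite -!catA; [apply: h|apply: h']. Qed.

Lemma moves_fun g ga ga' ga'' : moves g ga ga' -> moves g ga ga'' -> ga' = ga''.
Proof.
move=> [[x [r e]] h _] [_ h' _].
by apply: (@catr_inj _ r); rewrite -(h _ _ e) -(h' _ _ e).
Qed.

Lemma movesM g h ga ga' ga'' :
  moves g ga ga' -> moves h ga' ga'' -> moves (g * h) ga ga''.
Proof.
move=> [lg g1 g2] [_ h1 h2]; split=> // x r e.
  by rewrite actM; apply/h1/g1.
by rewrite invgM actM; apply/g2/h2.
Qed.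

Lemma moves_kids g ga ga' : moves g ga ga' -> kids ga = kids ga'.
Proof.
move=> m; apply: eq_filter => c; apply/asboolP/asboolP.
  by rewrite -!cats1 => h; apply: (moves_live (moves_cat h m)).
case: m => [_ _ h] [x [r]]; rewrite cat_rcons => /h e.
by exists (to x g^-1), r; rewrite cat_rcons.
Qed.

Lemma moves_codefrom g ga ga' d : moves g ga ga' -> live (ga ++ d) ->
  codefrom ga d = codefrom ga' d.
Proof.
elim: d ga ga' => //= c d ih ga ga' m; rewrite -cat_rcons => hl.
rewrite (moves_kids m); congr (_ ++ _); apply: ih => //.
by rewrite -!cats1; apply: moves_cat m; rewrite cats1; apply: live_catl hl.
Qed.

(** Once [g] has rewritten [ga] into [d], the rule for [g^-1] on [d] must give back [ga], because
    [g^-1] undoes [g] on an encoding beginning with [ga]. *)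
Lemma movesP g N : exists N', forall ga, live ga -> deep N' ga ->
  exists2 ga', moves g ga ga' & deep N ga'.
Proof.
have [N1 h1] := locally_rewritesT g; have [N2 h2] := locally_rewritesT g^-1.
(* The rule for [g] consumes [N1] letters; those left must feed the rule for [g^-1], of length [N2],
   and provide the depth [N]. *)
exists (N1 + maxn N N2)%N => ga lga [sga|[x <-]]; last first.
  by exists (enc (to x g)); [apply: moves_terminal | right; exists (to x g)].
have [|ga1 r1] := h1 (take N1 ga); first by rewrite size_takel //; lia.
pose d := ga1 ++ drop N1 ga.
have sd : (maxn N N2 <= size d)%N by rewrite size_cat size_drop; lia.
have rd : rewrites g ga d.
  move=> x r e; rewrite -catA; apply: r1.
  by rewrite catA cat_take_drop.
have [|ga2 r2] := h2 (take N2 d); first by rewrite size_takel //; lia.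
have rd' : rewrites g^-1 d (ga2 ++ drop N2 d).
  move=> x r e; rewrite -catA; apply: r2.
  by rewrite catA cat_take_drop.
exists d; last by left; lia.
have e2 : ga = ga2 ++ drop N2 d.
  case: lga => x [r e]; apply: (@catr_inj _ r).
  by have := rd' _ _ (rd _ _ e); rewrite actK e.
by split=> //; rewrite e2.
Qed.

Definition cantor_moves g x y := exists ga ga' eta,
  [/\ moves g ga ga', x = prepend (code ga) eta & y = prepend (code ga') eta].

Lemma cantor_moves_extend g ga d ga' x y eta : moves g ga ga' -> live (ga ++ d) ->
  prepend (code ga) x = prepend (code (ga ++ d)) eta -> y = prepend (code ga') x ->
  y = prepend (code (ga' ++ d)) eta.
Proof.
move=> m hl; rewrite /code !codefrom_cat !prepend_cat => /prepend_inj -> ->.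
by rewrite -(moves_codefrom m hl).
Qed.

(** Two words whose codes begin the same point are comparable, and the move of the shorter one
    extends to the longer one. *)
Lemma cantor_moves_fun g x y y' :
  cantor_moves g x y -> cantor_moves g x y' -> y = y'.
Proof.
move=> [ga [ga' [eta [m ex ey]]]] [de [de' [eta' [m' ex' ey']]]].
have lga : live ga by case: m. have lde : live de by case: m'.
rewrite ex in ex'; have [d [ed|ed]] := code_comparable lga lde ex'; subst.
  rewrite (cantor_moves_extend m lde ex' erefl).
  by rewrite (moves_fun m' (moves_cat lde m)).
rewrite (cantor_moves_extend m' lga (esym ex') erefl).
by rewrite (moves_fun m (moves_cat lga m')).
Qed.

Hypothesis live0 : live [::].

Lemma cantor_moves_total g x : exists y, cantor_moves g x y.
Proof.
have [N hN] := movesP g 0; have [ga [eta [lga dga _ ->]]] := parse N x live0.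
by have [ga' m _] := hN _ lga dga; exists (prepend (code ga') eta), ga, ga', eta.
Qed.

Definition cantor_act g x : cantor := projT1 (cid (cantor_moves_total g x)).

Lemma cantor_actE g x y : cantor_moves g x y -> cantor_act g x = y.
Proof. by rewrite /cantor_act; case: cid => y' /= h; apply: cantor_moves_fun. Qed.

Lemma cantor_actM g h : cantor_act (g * h) = cantor_act h \o cantor_act g.
Proof.
apply/funext => x /=; have [N hN] := movesP h 0; have [N' hN'] := movesP g N.
have [ga [eta [lga dga _ ->]]] := parse N' x live0.
have [ga' m dga'] := hN' _ lga dga.
have [ga'' m' _] := hN _ (moves_live m) dga'.
rewrite (@cantor_actE g _ (prepend (code ga') eta)); last by exists ga, ga', eta.
rewrite (@cantor_actE h _ (prepend (code ga'') eta)); last by exists ga', ga'', eta.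
by apply: cantor_actE; exists ga, ga'', eta; split=> //; apply: movesM m m'.
Qed.

Lemma cantor_act1 : cantor_act 1 = id.
Proof.
apply/funext => x; apply: cantor_actE; exists [::], [::], x.
by split=> //; [split=> // y r; rewrite ?invg1 act1 | rewrite prepend_nil..].
Qed.

Lemma cantor_act_thompson g : is_thompson (cantor_act g).
Proof.
have [N hN] := movesP g 0.
(* At most [N] letters are parsed, and each has a code of at most [size l] bits. *)
apply: (@bijective_is_thompson _ (cantor_act g^-1) (N * size l)%N).
- by move=> x; have := cantor_actM g g^-1; rewrite mulgV cantor_act1 => /(congr1 (@^~ x)).
- by move=> x; have := cantor_actM g^-1 g; rewrite mulVg cantor_act1 => /(congr1 (@^~ x)).
move=> w sw; have [ga [eta [lga dga sga e]]] := parse N (prepend w (fun=> false)) live0.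
have [ga' m _] := hN _ lga dga.
have [|d -> _] := prepend_comparable _ (esym e).
  rewrite sw; apply: leq_trans (size_codefrom _ _) _.
  by rewrite leq_mul2r sga orbT.
exists (code ga' ++ d) => y; apply: cantor_actE.
by exists ga, ga', (prepend d y); rewrite !prepend_cat.
Qed.

Hypothesis faithful : faithful_action to.

(** The code of [enc x] followed by zeros moves as [x] does, and it determines [x]. *)
Lemma cantor_act_inj : injective cantor_act.
Proof.
move=> g h e; suff gh x : to x g = to x h.
  have : g * h^-1 = 1 by apply: faithful => x; rewrite actM gh actK.
  by move/(congr1 (fun z => z * h)); rewrite mulgVK mul1g.
pose z : cantor := fun=> false.
have hg : cantor_act g (prepend (code (enc x)) z) = prepend (code (enc (to x g))) z.
  by apply: cantor_actE; exists (enc x), (enc (to x g)), z; split=> //; apply: moves_terminal.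
have hh : cantor_act h (prepend (code (enc x)) z) = prepend (code (enc (to x h))) z.
  by apply: cantor_actE; exists (enc x), (enc (to x h)), z; split=> //; apply: moves_terminal.
have lenc y : live (enc y) by exists y, [::]; rewrite cats0.
move: hh; rewrite -e hg => /code_comparable[//|//|d [|]] /enc_prefix //.
Qed.

End StackAction.

Lemma stack_action_embeds (G : groupType) (S : generating_system G) (X : Type)
    (to : right_action G X) (T : eqType) (enc : X -> seq T) (l : seq T) :
  faithful_action to ->
  (forall x, all (mem l) (enc x)) ->
  (forall x y r, enc x = enc y ++ r -> x = y) ->
  (forall a : S, locally_rewrites to enc (gen_eval a)) ->
  embeds G thompsonV.
Proof.
move=> fth encl encp encr; have [[x0 _]|noX] := pselect (exists x : X, True).
  have l0 : live enc [::] by exists x0, (enc x0).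
  apply: (@embeds_thompson _ (cantor_act encl encp encr l0)).
  - exact: cantor_act_thompson.
  - exact: cantor_actM.
  - exact: cantor_act_inj.
(* A faithful action on an empty set forces [G] to be trivial. *)
have G1 g : g = 1 :> G by apply: fth => x; case: noX; exists x.
apply: (@embeds_thompson _ (fun=> idfun)) => [g|g h|g h _].
- exact: is_thompson_id.
- exact: erefl.
- by rewrite (G1 g) (G1 h).
Qed.

(** * Subgroups of Thompson's group *)

Section Walk.
Variables (G : groupType) (S : generating_system G) (X : Type).
Variable to : right_action G X.
Implicit Types (x y : X) (w s : seq S).

Definition walk x w := to x (\prod_(a <- w) gen_eval a).

Lemma walk_nil x : walk x [::] = x.
Proof. by rewrite /walk big_nil act1. Qed.

Lemma walk_cons x a w : walk x (a :: w) = walk (to x (gen_eval a)) w.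
Proof. by rewrite /walk big_cons actM. Qed.

Lemma walk1 x a : walk x [:: a] = to x (gen_eval a).
Proof. by rewrite walk_cons walk_nil. Qed.

Lemma walk_cat x w s : walk x (w ++ s) = walk (walk x w) s.
Proof. by rewrite /walk big_cat actM. Qed.

Lemma orbit_walk xi x : orbit_set to xi x -> exists w, walk xi w = x.
Proof. by move=> [g _ <-]; have [w ->] := gen_generates S g; exists w. Qed.

Lemma Sch_path xi (x y : vertex (Sch S to xi)) w :
  (exists2 p, is_path x p y & w = map (@lab S (Sch S to xi)) p) <->
  walk (sval x) w = sval y.
Proof.
split=> [[p hp ->]|].
  elim: p x hp => [|[z a] p ih] x /=; first by move=> ->; rewrite walk_nil.
  by move=> [ex hp]; rewrite walk_cons -(ih _ hp) -ex.
elim: w x => [|a w ih] x.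
  by rewrite walk_nil => e; exists [::] => //; apply: (@sch_vertex_inj _ _ to xi x y e).
rewrite walk_cons => /(ih (@sch_tgt _ S _ to xi (x, a)))[p hp ->].
by exists ((x, a) :: p).
Qed.

Lemma Sch_language xi (x : vertex (Sch S to xi)) :
  closed_path_language x = [set w | walk (sval x) w = sval x].
Proof. by apply/seteqP; split=> w h; apply: (Sch_path x x w).1 || apply: (Sch_path x x w).2. Qed.

Lemma Sch_connected xi : graph_connected (Sch S to xi).
Proof.
move=> x y; have [g _ gx] := svalP x; have [h _ hy] := svalP y.
have [|w hw] := @orbit_walk (sval x) (sval y).
  by exists (g^-1 * h) => //; rewrite -gx actM -(actM to _ g) mulgV act1.
by have [p hp _] := (Sch_path x y w).2 hw; exists p.
Qed.

Lemma context_free_graphP xi : context_free_graph (Sch S to xi) <->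
  forall x, orbit_set to xi x -> context_free_language [set w | walk x w = x].
Proof.
split=> [[_ h] x hx|h]; first by have := h (exist _ x hx); rewrite Sch_language.
split=> [|x]; first exact: Sch_connected.
by rewrite Sch_language; apply: h; apply: svalP.
Qed.

End Walk.

(** * Eventually constant points of the Cantor set *)

Section EventuallyConstant.
Variable t : bool.
Let tail : cantor := fun=> t.

(** Normal form of a prefix before the tail [t t t ...]; the default [~~ t] makes the empty word
    trimmed. *)
Definition trimmed (u : seq bool) := last (~~ t) u != t.

Lemma prepend_tail : prepend [:: t] tail = tail.
Proof. by apply/funext => -[|n]. Qed.

Lemma exists_trimmed u : exists2 v, trimmed v & prepend v tail = prepend u tail.
Proof.
elim/last_ind: u => [|u c [v tv ev]].
  by exists [::] => //; rewrite /trimmed /=; case: t.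
have [->|ct] := eqVneq c t; last first.
  by exists (rcons u c) => //; rewrite /trimmed last_rcons.
by exists v => //; rewrite ev -cats1 prepend_cat prepend_tail.
Qed.

Lemma prepend_tail_nil d : tail = prepend d tail -> trimmed d -> d = [::].
Proof.
case/lastP: d => // d c /(congr1 (@^~ (size d))).
rewrite /prepend size_rcons leqnn nth_rcons ltnn eqxx /tail /trimmed last_rcons.
by move=> ->; rewrite eqxx.
Qed.

Lemma trimmed_inj u v : trimmed u -> trimmed v ->
  prepend u tail = prepend v tail -> u = v.
Proof.
wlog h : u v / (size u <= size v)%N.
  by move=> W tu tv e; case/orP: (leq_total (size u) (size v)) => h;
    [|symmetry]; apply: W.
move=> tu tv /(prepend_comparable h)[d ev /prepend_tail_nil dn].
case/lastP: d dn ev tv => [|d c] dn -> tv; first by rewrite cats0.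
have /dn : trimmed (rcons d c) by move: tv; rewrite /trimmed last_cat !last_rcons.
by case: d {dn tv}.
Qed.

End EventuallyConstant.

(** A single constant tail may absorb letters of the prefix; two different tails cannot absorb the
    same letter. *)
Lemma prepend_two_tails u v :
  (forall t : bool, prepend u (fun=> t) = prepend v (fun=> t)) -> u = v.
Proof.
wlog h : u v / (size u <= size v)%N.
  by move=> W e; case/orP: (leq_total (size u) (size v)) => h;
    [|symmetry]; apply: W.
move=> e; have [d ev e1] := prepend_comparable h (e true).
have := e false; rewrite ev prepend_cat => /prepend_inj e0.
case: d {ev} e0 e1 => [|c d]; first by rewrite cats0.
move=> /(congr1 (@^~ 0)) e0 /(congr1 (@^~ 0)).
by move: e0; rewrite /prepend /= => <-.
Qed.

(** Levi's lemma for free monoids. *)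
Lemma cat_eq_cat (T : Type) (a b c d : seq T) : a ++ b = c ++ d ->
  (size d <= size b)%N -> exists e, b = e ++ d /\ c = a ++ e.
Proof.
move=> e h; have sac : (size a <= size c)%N by move: (congr1 size e); rewrite !size_cat; lia.
have ea : a = take (size a) c.
  by move: (congr1 (take (size a)) e); rewrite take_size_cat // takel_cat.
have ec : c = a ++ drop (size a) c by rewrite {1}ea cat_take_drop.
exists (drop (size a) c); split=> //.
by move: (congr1 (drop (size a)) e); rewrite {1}ec -catA !drop_size_cat.
Qed.

(** * Groups acting on the Cantor set by a finite prefix table *)

Section ThompsonSubgroup.
Variables (G : groupType) (S : generating_system G).
Variables (to : right_action G cantor) (N : nat).
Variable p : S -> seq bool -> seq bool.
Hypothesis pP : forall a w, size w = N ->
  forall eta, to (prepend w eta) (gen_eval a) = prepend (p a w) eta.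

Definition table : set (seq bool * S * seq bool) :=
  [set r | size r.1.1 = N /\ r.2 = p r.1.2 r.1.1].

Lemma run_walk u s v : run table u s v ->
  forall eta, walk to (prepend u eta) s = prepend v eta.
Proof.
elim=> {u s v} [u|al a be x s v [/= sal ->] _ ih] eta; first exact: walk_nil.
by rewrite walk_cons prepend_cat pP // -prepend_cat ih.
Qed.

Lemma run_total s : exists K, forall u, (K <= size u)%N -> exists v, run table u s v.
Proof.
elim: s => [|a s [K hK]]; first by exists 0 => u _; exists u; apply: run_nil.
exists (N + K)%N => u hu; have su : size (take N u) = N by rewrite size_takel //; lia.
have [|v hv] := hK (p a (take N u) ++ drop N u).
  by rewrite size_cat size_drop; lia.
exists v; rewrite -(cat_take_drop N u).
by apply: run_cons hv.
Qed.

(** Here [x] is the part of the stack that the run never reads, and [m] is what stands above it when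
    the stack is cut at its lowest level. *)
Lemma run_low u s v : run table u s v -> exists x u' v' s1 s2 m,
  [/\ u = u' ++ x, v = v' ++ x, s = s1 ++ s2, (size m <= N)%N &
      run table u' s1 m /\ run table m s2 v'].
Proof.
elim=> {u s v} [u|al a be y s v hR hs [x [u' [v' [s1 [s2 [m [eu ev -> sm [h1 h2]]]]]]]]].
  exists (drop N u), (take N u), (take N u), [::], [::], (take N u).
  by rewrite cat_take_drop size_take_min geq_minl; split=> //; split; apply: run_nil.
have [sal _] := hR.
case: (leqP (size x) (size y)) => sxy.
  have [d [ey eu']] := cat_eq_cat eu sxy.
  exists x, (al ++ d), v', (a :: s1), s2, m.
  split=> //; first by rewrite -catA -ey.
  by split=> //; apply: run_cons hR _; rewrite -eu'.
(* The first step reads deeper than all later ones, so the cut is made before it. *)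
have [x' [ex ebe]] := cat_eq_cat (esym eu) (ltnW sxy).
exists y, al, (v' ++ x'), [::], (a :: (s1 ++ s2)), al.
split=> //; [by rewrite ev ex catA | by rewrite sal | split; first exact: run_nil].
rewrite -[X in run _ X _ _]cats0; apply: run_cons hR _; rewrite cats0 ebe.
by apply: run_cat (run_suffix _ _); [exact: run_suffix h1 | ].
Qed.

Definition base (i : N.-bseq bool * bool) : cantor := prepend i.1 (fun=> i.2).

(** A run of [g] from [u' ++ x] to [v' ++ x] is cut at its lowest stack [m ++ x]. With a constant
    tail in place of [x] it passes through a base point, so [g] fixes its start; doing this for both
    tails gives [u' = v']. *)
Lemma base_detects g :
  (forall i h, to (to (base i) h) g = to (base i) h) -> forall x, to x g = x.
Proof.
move=> fix_g x; have [s eg] := gen_generates S g.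
have [K hK] := run_total s.
have [|v hv] := hK (mkseq x K); first by rewrite size_mkseq.
rewrite (prepend_take K x) eg -/(walk to _ s) (run_walk hv).
congr (prepend _ _).
have [y [u' [v' [s1 [s2 [m [-> -> es sm [h1 h2]]]]]]]] := run_low hv.
congr (_ ++ _); apply/esym/prepend_two_tails => t.
have hu : prepend u' (fun=> t) =
    to (base (Bseq sm, t)) (\prod_(a <- s1) gen_eval a)^-1.
  by rewrite /base /= -(run_walk h1) /walk -actM mulgV act1.
have := fix_g (Bseq sm, t) (\prod_(a <- s1) gen_eval a)^-1.
by rewrite -hu eg -/(walk to _ s) es (run_walk (run_cat h1 h2)).
Qed.

Section Tail.
Variable t : bool.
Let tail : cantor := fun=> t.

Lemma trim_ex (aw : S * seq bool) : exists q, trimmed t q /\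
  prepend q tail = to (prepend aw.2 tail) (gen_eval aw.1).
Proof.
(* Padding with [N] letters of the tail makes the word long enough for the table. *)
case: aw => a w /=; pose u := w ++ nseq N t.
have nt n : prepend (nseq n t) tail = tail.
  by elim: n => [|n ih]; rewrite ?prepend_nil //= -cat1s prepend_cat ih prepend_tail.
have eu : prepend w tail = prepend u tail by rewrite prepend_cat nt.
have [q tq eq] := exists_trimmed t (p a (take N u) ++ drop N u).
have su : size (take N u) = N by rewrite size_takel // size_cat size_nseq leq_addl.
exists q; split=> //.
by rewrite eq eu prepend_cat -(pP a su) -prepend_cat cat_take_drop.
Qed.

Lemma orbit_trimmed w g : exists2 u, trimmed t u & to (prepend w tail) g = prepend u tail.
Proof.
have [s ->] := gen_generates S g; rewrite -/(walk to _ s).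
elim: s w => [|a s ih] w.
  by rewrite walk_nil; have [u tu e] := exists_trimmed t w; exists u.
by rewrite walk_cons; have [q [_ /= <-]] := trim_ex (a, w); apply: ih.
Qed.

Let q aw := projT1 (cid (trim_ex aw)).

Let q_trimmed aw : trimmed t (q aw).
Proof. by rewrite /q; case: cid => ? []. Qed.

Let qP a w : prepend (q (a, w)) tail = to (prepend w tail) (gen_eval a).
Proof. by rewrite /q; case: cid => ? []. Qed.

Definition bottomed u : seq (option bool) := rcons (map Some u) None.

(* [None] marks the bottom of the stack, below which only [t] occurs. *)
Definition stack_table : set (seq (option bool) * S * seq (option bool)) :=
  [set r | (exists2 w, size w = N &
              r = (map Some w, r.1.2, map Some (p r.1.2 w))) \/
           (exists2 w, (size w <= N)%N &
              r = (bottomed w, r.1.2, bottomed (q (r.1.2, w))))].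

Fixpoint stack_value (w : seq (option bool)) : cantor :=
  if w is Some b :: w' then prepend [:: b] (stack_value w') else tail.

Lemma stack_value_cat u r : stack_value (map Some u ++ r) = prepend u (stack_value r).
Proof. by elim: u => [|b u ih] /=; rewrite ?prepend_nil // ih -prepend_cat. Qed.

Lemma stack_value_bottomed u r : stack_value (bottomed u ++ r) = prepend u tail.
Proof. by rewrite cat_rcons stack_value_cat. Qed.

Lemma stack_run_walk u s v : run stack_table u s v ->
  walk to (stack_value u) s = stack_value v.
Proof.
elim=> {u s v} [u|al a be x s v hR _ <-]; first exact: walk_nil.
rewrite walk_cons; congr walk.
case: hR => -[w sw /= [-> ->]]; first by rewrite !stack_value_cat pP.
by rewrite !stack_value_bottomed qP.
Qed.

(** A word longer than [N] keeps its last letter when its first [N] letters are rewritten; a shorter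
    one is rewritten together with the bottom mark, and [q] gives a trimmed result. *)
Lemma stack_run_total u s : trimmed t u ->
  exists2 v, trimmed t v & run stack_table (bottomed u) s (bottomed v).
Proof.
elim: s u => [|a s ih] u tu; first by exists u => //; apply: run_nil.
case: (leqP (size u) N) => su.
  have [v tv hv] := ih _ (q_trimmed (a, u)); exists v => //.
  rewrite -(cats0 (bottomed u)); apply: (@run_cons _ _ _ _ _ (bottomed (q (a, u)))).
    by right; exists u.
  by rewrite cats0.
have [|v tv hv] := ih (p a (take N u) ++ drop N u).
  move: tu; rewrite /trimmed -{1}(cat_take_drop N u) !last_cat.
  case: (drop N u) (size_drop N u) => //=; lia.
exists v => //; rewrite /bottomed -(cat_take_drop N u) map_cat rcons_cat.
apply: (@run_cons _ _ _ _ _ (map Some (p a (take N u)))).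
  by left; exists (take N u) => //; rewrite size_takel // ltnW.
by rewrite -rcons_cat -map_cat.
Qed.

Lemma stack_table_bounded : exists M, forall al a be, stack_table (al, a, be) ->
  (size al <= M)%N /\ (size be <= M)%N.
Proof.
pose K := \max_(aw : S * N.-bseq bool)
  maxn (size (p aw.1 aw.2)) (size (q (aw.1, bseqval aw.2))).
have leK a w (sw : (size w <= N)%N) :
    (maxn (size (p a w)) (size (q (a, w))) <= K)%N.
  exact: (@leq_bigmax _ (fun aw : S * N.-bseq bool => maxn (size (p aw.1 aw.2))
    (size (q (aw.1, bseqval aw.2)))) (a, Bseq sw)).
exists (N + K).+1 => al a be [] [w sw /= [-> ->]].
  by have := leK a w; rewrite sw !size_map => /(_ (leqnn _)); lia.
by have := leK a w sw; rewrite !size_rcons !size_map; lia.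
Qed.

(** Trimmed words represent points uniquely, so a word fixes the point exactly when it labels a run
    from the corresponding stack to itself. *)
Lemma tail_language_context_free u :
  context_free_language [set s : seq S | walk to (prepend u tail) s = prepend u tail].
Proof.
have [v tv <-] := exists_trimmed t u.
have [M hM] := stack_table_bounded.
suff -> : [set s : seq S | walk to (prepend v tail) s = prepend v tail] =
    [set s | run stack_table (bottomed v) s (bottomed v)].
  apply: (@run_context_free _ _ _ (M + size (bottomed v))%N); rewrite ?leq_addl //.
  by move=> al a be /hM[h1 h2]; split; rewrite (leq_trans _ (leq_addr _ _)).
have ev w : stack_value (bottomed w) = prepend w tail.
  by rewrite -(cats0 (bottomed w)) stack_value_bottomed.
apply/seteqP; split=> s /= h; last by move: (stack_run_walk h); rewrite ev.
have [w tw hw] := stack_run_total s tv.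
have := stack_run_walk hw; rewrite !ev h => /(trimmed_inj tv tw) e.
by rewrite {2}e.
Qed.

End Tail.

Lemma base_orbit_context_free i g : let x := to (base i) g in
  context_free_language [set s : seq S | walk to x s = x].
Proof.
case: i => w t /=; rewrite /base /=; have [u _ ->] := orbit_trimmed t w g.
exact: tail_language_context_free.
Qed.

End ThompsonSubgroup.

(** * Restriction of an action to finitely many orbits *)

Section Restriction.
Variables (G : groupType) (S : generating_system G) (Y : Type).
Variables (to : right_action G Y) (I : finType) (base : I -> Y).

Definition base_orbits := {y : Y | exists i g, y = to (base i) g}.

Lemma base_orbits_act (y : base_orbits) g : exists i h, to (sval y) g = to (base i) h.
Proof. by have [i [h e]] := svalP y; exists i, (h * g); rewrite actM -e. Qed.

Definition restrict (y : base_orbits) g : base_orbits :=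
  exist _ (to (sval y) g) (base_orbits_act y g).

Lemma base_orbits_inj (x y : base_orbits) : sval x = sval y -> x = y.
Proof. by case: x y => x hx [y hy] /= e; apply: eq_exist. Qed.

Lemma restrict1 y : restrict y 1 = y.
Proof. by apply: base_orbits_inj; rewrite /= act1. Qed.

Lemma restrictM y g h : restrict y (g * h) = restrict (restrict y g) h.
Proof. by apply: base_orbits_inj; rewrite /= actM. Qed.

Definition restricted := RightAction restrict1 restrictM.

Lemma restricted_orbits : finitely_many_orbits restricted.
Proof.
have hb i : exists j g, base i = to (base j) g by exists i, 1; rewrite act1.
exists #|I|, (fun k => exist _ (base (enum_val k)) (hb (enum_val k)) : base_orbits).
apply/seteqP; split=> // -[y hy] _; have [i [g ey]] := hy.
exists (enum_rank i) => //; exists g => //.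
by apply: base_orbits_inj; rewrite /= enum_rankK.
Qed.

End Restriction.

(** The group acts on the Cantor set through [phi]; the context-free action is the restriction to
    the orbits of the base points. *)
Lemma embeds_CF_TR (G : groupType) (S : generating_system G) :
  embeds G thompsonV -> CF_TR S.
Proof.
move=> [phi phiI].
have phi1 : phi 1 = 1 by apply: (@mulgI _ (phi 1)); rewrite -gmulfM !mulg1.
pose cact (x : cantor) (g : G) : cantor := phi g x.
have cact1 x : cact x 1 = x by rewrite /cact phi1.
have cactM x g h : cact x (g * h) = cact (cact x g) h by rewrite /cact gmulfM.
pose to := RightAction cact1 cactM.
have /choice[L LP] : forall a : S, exists L, forall N, (L <= N)%N ->
    exists p : seq bool -> seq bool, forall w, size w = N ->
    forall eta, to (prepend w eta) (gen_eval a) = prepend (p w) eta.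
  move=> a; have [L hL] := is_thompson_level (asboolW (thompson_funP (phi (gen_eval a)))).
  (* The default tuple only serves to make the table total on words of other lengths. *)
  exists L => N /hL[p _ hp]; exists (fun w => p (insubd [tuple of nseq N false] w)).
  move=> w /eqP sw eta; rewrite -hp.
  by congr (thompson_fun _ (prepend _ _)); rewrite val_insubd sw.
pose N := \max_a L a.
have /choice[p pP] : forall a : S, exists p : seq bool -> seq bool,
    forall w, size w = N -> forall eta,
    to (prepend w eta) (gen_eval a) = prepend (p w) eta.
  by move=> a; apply: LP; apply: leq_bigmax.
exists (base_orbits to (@base N)), (restricted to (@base N)); split.
  move=> g fix_g; apply: phiI; rewrite phi1; apply: val_inj; apply/funext.
  apply: (base_detects pP) => i h.
  have hi : exists j k, to (base i) h = to (@base N j) k by exists i, h.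
  by have /(congr1 sval) := fix_g (exist _ _ hi).
split=> [|xi]; first exact: restricted_orbits.
apply/context_free_graphP => -[x hx] _; have [i [g ex]] := hx.
pose y : base_orbits to (@base N) := exist _ x hx.
suff -> : [set w | walk (restricted to (@base N)) y w = y] =
    [set w : seq S | walk to x w = x].
  by rewrite ex; apply: base_orbit_context_free pP _ _.
apply/seteqP; split=> w /=; first by move=> /(congr1 sval).
by move=> e; apply: base_orbits_inj.
Qed.

(** * Chords of closed paths in a Schreier graph *)

Section Inverse.
Variables (G : groupType) (S : generating_system G) (X : Type).
Variable to : right_action G X.
Local Notation walk := (@walk G S X to).

Definition winv (w : seq S) : seq S := rev (map (@linv S) w).

Lemma size_winv w : size (winv w) = size w.
Proof. by rewrite size_rev size_map. Qed.

Lemma winv_cons a w : winv (a :: w) = winv w ++ [:: linv a].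
Proof. by rewrite /winv /= rev_cons cats1. Qed.

Lemma act_linv x (a : S) : to (to x (gen_eval a)) (gen_eval (linv a)) = x.
Proof. by rewrite gen_linv actK. Qed.

Lemma walkK x w : walk (walk x w) (winv w) = x.
Proof.
elim: w x => [|a w ih] x; first by rewrite !walk_nil.
by rewrite winv_cons walk_cat walk1 walk_cons ih act_linv.
Qed.

Lemma walk_inj w : injective (walk^~ w).
Proof. by move=> x y /(congr1 (walk^~ (winv w))); rewrite !walkK. Qed.

Definition near K x y := exists2 w, (size w <= K)%N & walk x w = y.

Lemma near_sym K x y : near K x y -> near K y x.
Proof. by move=> [w sw <-]; exists (winv w); rewrite ?size_winv ?walkK. Qed.

Lemma near_trans K L x y z : near K x y -> near L y z -> near (K + L) x z.
Proof.
by move=> [w sw <-] [s ss <-]; exists (w ++ s); rewrite ?walk_cat // size_cat leq_add.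
Qed.

Lemma near_le K L x y : (K <= L)%N -> near K x y -> near L x y.
Proof. by move=> h [w sw e]; exists w => //; apply: leq_trans h. Qed.

Lemma near_refl K x : near K x x.
Proof. by exists [::]; rewrite ?walk_nil. Qed.

(** * Chords given by a grammar, and induction along them *)

Section Chords.
Variables (x0 : X) (g : cfg S).
Hypothesis gP : forall w, walk x0 w = x0 <-> yields [:: inl (start g)] w.
Local Notation form := (seq (nonterminal g + S)).

Definition links (f : form) y z := forall w, yields f w -> walk y w = z.

Lemma short_yields_seq (fs : seq form) : exists K, forall f w, f \in fs ->
  yields f w -> exists2 w', (size w' <= K)%N & yields f w'.
Proof.
elim: fs => [|f fs [K hK]]; first by exists 0.
have [[w0 h0]|no] := pselect (exists w, yields f w).
  exists (maxn (size w0) K) => f' w; rewrite in_cons => /orP[/eqP-> _|hf hw].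
    by exists w0 => //; rewrite leq_maxl.
  by have [w' sw' hw'] := hK f' w hf hw; exists w' => //; rewrite leq_max sw' orbT.
exists K => f' w; rewrite in_cons => /orP[/eqP-> hw|]; last exact: hK.
by case: no; exists w.
Qed.

Definition short_bound K :=
  (forall X w, yields [:: inl X : nonterminal g + S] w ->
     exists2 w', (size w' <= K)%N & yields [:: inl X : nonterminal g + S] w') /\
  (forall X (f1 f2 : form), (X, f1 ++ f2) \in productions g ->
     (forall w, yields f1 w -> exists2 w', (size w' <= K)%N & yields f1 w') /\
     (forall w, yields f2 w -> exists2 w', (size w' <= K)%N & yields f2 w')).

(** Only finitely many forms are concerned: the nonterminals, and the prefixes and suffixes of
    right-hand sides. *)
Lemma short_yields : exists2 K, (0 < K)%N & short_bound K.
Proof.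
pose fs1 : seq form := [seq [:: inl X] | X <- enum (nonterminal g)].
pose fs2 : seq form := flatten [seq [seq take i p.2 | i <- iota 0 (size p.2).+1]
  | p <- productions g].
pose fs3 : seq form := flatten [seq [seq drop i p.2 | i <- iota 0 (size p.2).+1]
  | p <- productions g].
have [K hK] := short_yields_seq (fs1 ++ fs2 ++ fs3).
have hK' f w : f \in fs1 ++ fs2 ++ fs3 -> yields f w ->
    exists2 w', (size w' <= K.+1)%N & yields f w'.
  by move=> hf /(hK _ _ hf)[w' sw' hw']; exists w' => //; apply: leqW.
exists K.+1 => //; split=> [Y w|Y f1 f2 hp].
  by apply: hK'; rewrite mem_cat map_f ?mem_enum.
split=> w; apply: hK'; rewrite !mem_cat.
  apply/orP; right; apply/orP; left; apply/flatten_mapP; exists (Y, f1 ++ f2) => //.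
  apply/mapP; exists (size f1); last by rewrite take_size_cat.
  by rewrite mem_iota size_cat; lia.
apply/orP; right; apply/orP; right; apply/flatten_mapP; exists (Y, f1 ++ f2) => //.
apply/mapP; exists (size f1); last by rewrite drop_size_cat.
by rewrite mem_iota size_cat; lia.
Qed.

(** With [w2] fixed, walking along it is injective, so all words derived from [f1] end at the same
    point. *)
Lemma links_catl f1 f2 y w1 w2 : yields f1 w1 -> yields f2 w2 ->
  links (f1 ++ f2) y (walk y (w1 ++ w2)) -> links f1 y (walk y w1).
Proof.
move=> h1 h2 hl w hw; apply: (@walk_inj w2).
by rewrite -!walk_cat; apply: hl; apply: yields_cat.
Qed.

Lemma links_catr f1 f2 y w1 w2 : yields f1 w1 -> yields f2 w2 ->
  links (f1 ++ f2) y (walk y (w1 ++ w2)) -> links f2 (walk y w1) (walk y (w1 ++ w2)).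
Proof.
by move=> h1 h2 hl w hw; rewrite -walk_cat; apply: hl; apply: yields_cat.
Qed.

Section Path.
Variable M : seq S.

Definition pt i := walk x0 (take i M).
Definition factor i j := take (j - i) (drop i M).
Lemma factor_cat i k j : (i <= k)%N -> (k <= j)%N ->
  factor i j = factor i k ++ factor k j.
Proof.
move=> ik kj; rewrite /factor; have -> : (j - i = (k - i) + (j - k))%N by lia.
by rewrite takeD drop_drop; congr (_ ++ take _ (drop _ _)); lia.
Qed.

Lemma pt_factor i j : (i <= j)%N -> pt j = walk (pt i) (factor i j).
Proof.
move=> ij; rewrite /pt -walk_cat /factor; congr walk.
by rewrite -takeD subnKC.
Qed.

Lemma factor_prefix i m1 m2 : m1 ++ m2 = factor i (i + size (m1 ++ m2)) ->
  m1 = factor i (i + size m1) /\ m2 = factor (i + size m1) (i + size (m1 ++ m2)).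
Proof.
move=> e; have := e; rewrite (@factor_cat i (i + size m1)) ?size_cat; try lia.
move=> e'.
have sz : size m1 = size (factor i (i + size m1)).
  move: (congr1 size e); rewrite /factor !size_take_min !size_drop size_cat; lia.
split; first by move: (congr1 (take (size m1)) e'); rewrite take_size_cat // take_size_cat.
by move: (congr1 (drop (size m1)) e'); rewrite drop_size_cat // drop_size_cat.
Qed.

Variables (K a b : nat).
Hypothesis KP : short_bound K.
Hypotheses (M_closed : walk x0 M = x0) (ab : (a <= b)%N) (bM : (b <= size M)%N).

Definition near_outside k := exists2 o,
  (o < a)%N \/ (b < o <= size M)%N & near K (pt o) (pt k).

Variable Q : nat -> nat -> Prop.
Hypothesis Q_refl : forall i, (a <= i <= b)%N -> Q i i.
Hypothesis Q_letter : forall i, (a <= i)%N -> (i < b)%N -> Q i i.+1.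
Hypothesis Q_link : forall i j X, (a <= i)%N -> (i <= j)%N -> (j <= b)%N ->
  links [:: inl X] (pt i) (pt j) -> yields [:: inl X : nonterminal g + S] (factor i j) -> Q i j.
Hypothesis Q_trans : forall i k j, (a <= i)%N -> (i <= k)%N -> (k <= j)%N -> (j <= b)%N ->
  near_outside k -> Q i k -> Q k j -> Q i j.

(* A node of the derivation tree spanning [i, j] meets the factor [a, b] of [M] in
   [clamp i, clamp j]; if it is not contained in [a, b], then one end of its chord
   lies outside, and the points where its production cuts it are near that end. *)
Definition clamp i := maxn a (minn i b).

Lemma clamp_trans i k j : (i <= k)%N -> (k <= j)%N ->
  ((a <= k <= b)%N -> near_outside k) ->
  Q (clamp i) (clamp k) -> Q (clamp k) (clamp j) -> Q (clamp i) (clamp j).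
Proof.
move=> ik kj nk h1 h2.
case: (ltnP k a) => ka; first by have -> : clamp i = clamp k by rewrite /clamp; lia.
case: (ltnP b k) => kb; first by have -> : clamp j = clamp k by rewrite /clamp; lia.
have ck : clamp k = k by rewrite /clamp; lia.
rewrite ck in h1 h2; apply: (@Q_trans _ k) h1 h2; first 4 last.
- by apply: nk; rewrite ka.
- by rewrite /clamp; lia.
- by rewrite /clamp; lia.
- by rewrite /clamp; lia.
- by rewrite /clamp; lia.
Qed.

(** Induction on the derivation: a subtree inside [[a, b]] is one chord, any other is cut along its
    production. The last premise provides for the cuts between siblings. *)
Lemma chord_decomposition (f : form) m : yields f m -> forall i,
  (i + size m <= size M)%N -> m = factor i (i + size m) ->
  links f (pt i) (pt (i + size m)) ->
  (forall f1 f2 m1 m2, f = f1 ++ f2 -> m = m1 ++ m2 -> f1 <> [::] -> f2 <> [::] ->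
     yields f1 m1 -> yields f2 m2 -> near_outside (i + size m1)) ->
  Q (clamp i) (clamp (i + size m)).
Proof.
elim=> {f m} [|c f m hf ih|Y rhs u f m hY hrhs ihrhs hf ih] i iM em hl hsplit.
- by rewrite addn0; apply: Q_refl; rewrite /clamp; lia.
- have [e1 e2] := @factor_prefix i [:: c] m em.
  have hc : yields [:: inr c : nonterminal g + S] [:: c].
    by apply: yields_letter; constructor.
  have ei : pt (i + size (c :: m)) = walk (pt i) ([:: c] ++ m).
    by have := pt_factor (leq_addr (size (c :: m)) i); rewrite -em.
  rewrite ei in hl.
  have ek : pt (i + 1) = walk (pt i) [:: c].
    by have := pt_factor (leq_addr 1 i); rewrite -e1.
  have Q1 : Q (clamp i) (clamp (i + 1)).
    rewrite addn1; case: (ltnP i a) => ia.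
      have -> : clamp i = clamp i.+1 by rewrite /clamp; lia.
      by apply: Q_refl; rewrite /clamp; lia.
    case: (ltnP i b) => ib.
      have [-> ->] : clamp i = i /\ clamp i.+1 = i.+1 by rewrite /clamp; lia.
      exact: Q_letter.
    have -> : clamp i = clamp i.+1 by rewrite /clamp; lia.
    by apply: Q_refl; rewrite /clamp; lia.
  case: f hf ih hl hsplit => [|x f] hf ih hl hsplit.
    by rewrite (yields_nilE hf).
  have es : (i + 1 + size m = i + size (c :: m))%N by rewrite /= -addnA add1n.
  have kj : (i + 1 <= i + size (c :: m))%N by rewrite -es leq_addr.
  apply: (clamp_trans (leq_addr 1 i) kj).
  + by move=> _; apply: (hsplit [:: inr c] (x :: f) [:: c] m).
  + exact: Q1.
  + rewrite -es; apply: ih; rewrite ?es //.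
      by rewrite ei ek; apply: (links_catr hc hf hl).
    move=> f1 f2 m1 m2 ef emm n1 n2 y1 y2; have -> : (i + 1 + size m1 = i + size (c :: m1))%N.
      by rewrite /= -addnA add1n.
    by apply: (hsplit (inr c :: f1) f2 (c :: m1) m2); rewrite ?ef ?emm //; apply: yields_letter.
have [e1 e2] := @factor_prefix i u m em.
have hu : yields [:: inl Y : nonterminal g + S] u.
  by rewrite -(cats0 u); apply: yields_rule hY hrhs (yields_nil _).
have ei : pt (i + size (u ++ m)) = walk (pt i) (u ++ m).
  by have := pt_factor (leq_addr (size (u ++ m)) i); rewrite -em.
rewrite ei in hl.
have ek : pt (i + size u) = walk (pt i) u.
  by have := pt_factor (leq_addr (size u) i); rewrite -e1.
have suM : (i + size u <= size M)%N by move: iM; rewrite size_cat; lia.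
have hlY : links [:: inl Y] (pt i) (pt (i + size u)).
  by rewrite ek; apply: (@links_catl [:: inl Y] f _ _ _ hu hf).
have Q1 : Q (clamp i) (clamp (i + size u)).
  case: (boolP ((a <= i) && (i + size u <= b))%N) => [/andP[ai ib]|out].
    have [-> ->] : clamp i = i /\ clamp (i + size u) = (i + size u)%N by rewrite /clamp; lia.
    by apply: (@Q_link _ _ Y) => //; [lia | rewrite -e1].
  apply: ihrhs => //.
    by move=> w hw; apply: hlY; rewrite -(cats0 w); apply: yields_rule hY hw (yields_nil _).
  move=> f1 f2 m1 m2 ef eu n1 n2 y1 y2.
  rewrite ef in hY; have [sh1 sh2] := KP.2 _ _ _ hY.
  have em1 : pt (i + size m1) = walk (pt i) m1.
    have e3 := e1; rewrite eu in e3; have [e4 _] := factor_prefix e3.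
    by have := pt_factor (leq_addr (size m1) i); rewrite -e4.
  have hl12 : links (f1 ++ f2) (pt i) (walk (pt i) (m1 ++ m2)).
    rewrite -eu -ek => w hw; apply: hlY; rewrite -(cats0 w).
    by apply: yields_rule hY hw (yields_nil _).
  (* If the chord starts before [a], a short word of [f1] joins its start to the cut; otherwise it
     ends after [b], and a short word of [f2] joins the cut to its end. *)
  case: (ltnP i a) => ia.
    have [w sw hw] := sh1 _ y1; exists i; first by left.
    by exists w => //; rewrite em1; apply: (links_catl y1 y2 hl12).
  have [w sw hw] := sh2 _ y2; exists (i + size u)%N.
    by right; rewrite suM andbT; move: out; rewrite ia /= -ltnNge.
  apply: near_sym; exists w => //; rewrite em1 ek eu.
  exact: (links_catr y1 y2 hl12).
case: f hf ih hl hsplit => [|x f] hf ih hl hsplit.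
  by rewrite (yields_nilE hf) cats0.
have es : (i + size u + size m = i + size (u ++ m))%N by rewrite size_cat addnA.
have kj : (i + size u <= i + size (u ++ m))%N by rewrite -es leq_addr.
apply: (clamp_trans (leq_addr (size u) i) kj).
+ by move=> _; apply: (hsplit [:: inl Y] (x :: f) u m).
+ exact: Q1.
+ rewrite -es; apply: ih; rewrite ?es //.
    by rewrite ei ek; apply: (links_catr hu hf hl).
  move=> f1 f2 m1 m2 ef emm n1 n2 y1 y2.
  rewrite -addnA -size_cat.
  apply: (hsplit (inl Y :: f1) f2 (u ++ m1) m2); rewrite ?ef ?emm ?catA //.
  exact: yields_rule hY hrhs y1.
Qed.

(** A factor of a closed path is assembled from letters and chords, and pieces are joined only at
    points near the rest of the path. *)
Lemma chord_induction : Q a b.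
Proof.
have hM : yields [:: inl (start g)] M by apply/gP.
have p0 : pt 0 = x0 by rewrite /pt take0 walk_nil.
have pM : pt (size M) = x0 by rewrite /pt take_size.
have := chord_decomposition hM (i := 0); rewrite add0n.
have -> : clamp 0 = a by rewrite /clamp; lia.
have -> : clamp (size M) = b by rewrite /clamp; lia.
apply => //.
- by rewrite /factor drop0 subn0 take_size.
- by rewrite p0 pM => w /gP.
(* The form at the root is a single nonterminal and has no proper cut. *)
- by move=> [|x [|y f1]] [|z f2].
Qed.

End Path.
End Chords.
End Inverse.

(** * Finitely many types of ends *)

Section Levels.
Variables (G : groupType) (S : generating_system G) (X : Type).
Variables (to : right_action G X) (n : nat) (r : 'I_n -> X).
Hypothesis r_cover : forall x, exists i, orbit_set to (r i) x.
Local Notation walk := (@walk G S X to).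
Local Notation near := (@near G S X to).

Lemma index_ex x : exists i, `[< orbit_set to (r i) x >].
Proof. by have [i h] := r_cover x; exists i; apply/asboolP. Qed.

(** Several [r i] may lie in one orbit; the canonical choice makes the root constant on orbits. *)
Definition orbit_index x : 'I_n := xchoose (index_ex x).
Definition root x := r (orbit_index x).

Lemma root_walk_ex x : exists w, walk (root x) w = x.
Proof. by apply: orbit_walk; have /asboolP := xchooseP (index_ex x). Qed.

Lemma orbit_index_act x g : orbit_index (to x g) = orbit_index x.
Proof.
apply: eq_xchoose => i; apply: asbool_equiv_eq; split=> -[h _ e].
  by exists (h * g^-1) => //; rewrite actM e actK.
by exists (h * g) => //; rewrite actM e.
Qed.

Lemma orbit_index_walk x w : orbit_index (walk x w) = orbit_index x.
Proof. exact: orbit_index_act. Qed.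

Lemma root_walk x w : root (walk x w) = root x.
Proof. by rewrite /root orbit_index_walk. Qed.

Lemma lev_ex x : exists k, `[< exists2 w, size w = k & walk (root x) w = x >].
Proof. by have [w hw] := root_walk_ex x; exists (size w); apply/asboolP; exists w. Qed.

Definition lev x := ex_minn (lev_ex x).

Lemma geodesic x : exists2 w, size w = lev x & walk (root x) w = x.
Proof. by rewrite /lev; case: ex_minnP => k /asboolP[w sw hw] _; exists w. Qed.

Lemma lev_le x w : walk (root x) w = x -> (lev x <= size w)%N.
Proof. by move=> h; rewrite /lev; case: ex_minnP => k _; apply; apply/asboolP; exists w. Qed.

Lemma lev_near K x y : near K x y -> (lev y <= lev x + K)%N.
Proof.
move=> [w sw <-]; have [s ss hs] := geodesic x.
apply: (@leq_trans (size (s ++ w))); last by rewrite size_cat ss leq_add2l.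
by apply: lev_le; rewrite root_walk walk_cat hs.
Qed.

Lemma lev_act x (a : S) : (lev (to x (gen_eval a)) <= (lev x).+1)%N /\
  (lev x <= (lev (to x (gen_eval a))).+1)%N.
Proof.
have h : near 1 x (to x (gen_eval a)) by exists [:: a]; rewrite ?walk1.
by have := lev_near h; have := lev_near (near_sym h); rewrite !addn1.
Qed.

Lemma rootK x : root (root x) = root x.
Proof. by have [w hw] := root_walk_ex x; rewrite -(root_walk _ w) hw. Qed.

Lemma lev_root x : lev (root x) = 0.
Proof.
apply/eqP; rewrite -leqn0; apply: (@lev_le _ [::]); rewrite walk_nil.
exact: rootK.
Qed.

Lemma lev_descend x m : lev x = m.+1 -> exists a : S, lev (to x (gen_eval a)) = m.
Proof.
move=> lx; have [w] := geodesic x; rewrite lx; case/lastP: w => // w b.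
rewrite size_rcons => -[sw]; rewrite -cats1 walk_cat walk1 => hb.
exists (linv b); have eb : to x (gen_eval (linv b)) = walk (root x) w.
  by rewrite -{1}hb act_linv.
have [_] := lev_act x (linv b); rewrite lx ltnS eb => h1.
apply/eqP; rewrite eqn_leq h1 andbT -sw; apply: lev_le.
by rewrite root_walk rootK.
Qed.

Fixpoint stays m x (w : seq S) : Prop :=
  (m <= lev x)%N /\ if w is a :: w' then stays m (to x (gen_eval a)) w' else True.

Lemma stays_start m x w : stays m x w -> (m <= lev x)%N.
Proof. by case: w => [|a w] []. Qed.

Lemma stays_cat m x u w : stays m x (u ++ w) <-> stays m x u /\ stays m (walk x u) w.
Proof.
elim: u x => [|a u ih] x /=.
  rewrite walk_nil; split=> [h|[]//]; split=> //; split=> //.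
  exact: stays_start h.
by have := ih (to x (gen_eval a)); rewrite walk_cons; tauto.
Qed.

Lemma stays_end m x w : stays m x w -> (m <= lev (walk x w))%N.
Proof. by rewrite -{1}(cats0 w) => /stays_cat[_ []]. Qed.

Lemma stays_le m m' x w : (m' <= m)%N -> stays m x w -> stays m' x w.
Proof.
by move=> h; elim: w x => [|a w ih] x /= [/(leq_trans h)]; split=> //; apply: ih.
Qed.

Lemma stays_winv m x w : stays m x w -> stays m (walk x w) (winv w).
Proof.
elim: w x => [|a w ih] x /=; first by rewrite walk_nil.
move=> [lx h]; rewrite winv_cons walk_cons; apply/stays_cat; split; first exact: ih.
by rewrite walkK /= act_linv; split=> //; apply: stays_start h.
Qed.

Lemma descend x k : (k <= lev x)%N -> exists t,
  [/\ size t = (lev x - k)%N, stays k x t & lev (walk x t) = k].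
Proof.
move=> kx; have [d e] : exists d, (lev x - k = d)%N by exists (lev x - k)%N.
elim: d x kx e => [|d ih] x kx e.
  by exists [::]; rewrite walk_nil; split=> //; lia.
have [|a ha] := @lev_descend x (k + d); first by lia.
have [||t [st ht lt]] := ih (to x (gen_eval a)); rewrite ?ha; try lia.
by exists (a :: t); rewrite walk_cons /= st ha; split=> //; lia.
Qed.

(* [sim x y]: an isomorphism of labelled graphs, respecting relative levels, from
   the component of [lev >= lev x] containing [x] to the component of
   [lev >= lev y] containing [y] maps [x] to [y]. *)
Definition sim x y := forall s,
  [/\ stays (lev x) x s <-> stays (lev y) y s,
      stays (lev x) x s -> (lev (walk x s) + lev y = lev (walk y s) + lev x)%N &
      forall t, stays (lev x) x s -> stays (lev x) x t ->
        walk x s = walk x t <-> walk y s = walk y t].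

(** * Ends within one orbit *)

Section Orbit.
Variables (x0 : X) (g : cfg S).
Hypothesis gP : forall w, walk x0 w = x0 <-> yields [:: inl (start g)] w.
Variable K : nat.
Hypotheses (K_gt0 : (0 < K)%N) (KP : short_bound g K).

Section Frontier.
Variables (v : X) (s : seq S).
Hypotheses (rv : root v = x0) (sv : stays (lev v) v s) (lvs : lev (walk v s) = lev v).

(** The closed path runs along a geodesic to [v], follows [s] and returns along a geodesic. Points
    of [s] have level at least [lev v], so a point of a geodesic within [K] of one of them is at
    most [K] steps away from an end of [s]. *)
Lemma frontier_word : exists M a b, [/\ walk x0 M = x0, (a <= b)%N, (b <= size M)%N,
  pt to x0 M a = v & pt to x0 M b = walk v s] /\ factor M a b = s /\
  forall k, (a <= k <= b)%N -> near_outside to x0 M K a b k ->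
     near (K + K) v (pt to x0 M k) \/ near (K + K) (walk v s) (pt to x0 M k).
Proof.
have [al sal hal] := geodesic v; rewrite rv in hal.
have [be sbe hbe] := geodesic (walk v s); rewrite root_walk rv in hbe.
pose M := al ++ s ++ winv be; exists M, (size al), (size al + size s)%N.
have sM : size M = (size al + size s + size be)%N by rewrite !size_cat size_winv addnA.
have pa : pt to x0 M (size al) = v by rewrite /pt take_size_cat.
have pb : pt to x0 M (size al + size s) = walk v s.
  by rewrite /pt /M catA take_size_cat ?size_cat // walk_cat hal.
have Mc : walk x0 M = x0.
  by rewrite /M !walk_cat hal -hbe walkK.
split; [split=> // | split].
- by rewrite leq_addr.
- by rewrite sM leq_addr.
- by rewrite /factor addKn /M drop_size_cat // take_size_cat.
move=> k /andP[ak kb] [o out on].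
have lk : (lev v <= lev (pt to x0 M k))%N.
  have -> : pt to x0 M k = walk v (take (k - size al) s).
    rewrite /pt /M take_cat ltnNge ak /= walk_cat hal take_cat.
    case: ltnP => // h; have -> : (k - size al - size s = 0)%N by lia.
    by rewrite take0 cats0 take_oversize.
  move: sv; rewrite -{1}(cat_take_drop (k - size al) s) => /stays_cat[h _].
  exact: stays_end h.
have lo := lev_near on.
have rx0 : root x0 = x0 by rewrite -rv rootK.
case: out => [oa|/andP[bo oM]].
  left; apply: near_trans on.
  have l1 : (lev (pt to x0 M o) <= o)%N.
    apply: leq_trans (lev_le (w := take o M) _) _; first by rewrite root_walk rx0.
    by rewrite size_take_min geq_minl.
  exists (winv (drop o al)); first by rewrite size_winv size_drop; lia.
  have -> : pt to x0 M o = walk x0 (take o al) by rewrite /pt /M takel_cat // ltnW.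
  by rewrite -hal -{1}(cat_take_drop o al) walk_cat walkK.
right; apply: near_trans on.
pose c := (o - (size al + size s))%N.
have eo : pt to x0 M o = walk (walk v s) (take c (winv be)).
  rewrite -pb /pt /M catA take_cat ltnNge size_cat (ltnW bo) /= walk_cat.
  by rewrite take_size_cat ?size_cat.
have l1 : (lev (pt to x0 M o) <= size be - c)%N.
  have e0 : walk x0 (winv (drop c (winv be))) = pt to x0 M o.
    rewrite eo -{1}(walkK to x0 be) hbe -{1}(cat_take_drop c (winv be)) walk_cat.
    exact: walkK.
  apply: leq_trans (lev_le (w := winv (drop c (winv be))) _) _.
    by rewrite -{1}e0 root_walk rx0.
  by rewrite size_winv size_drop size_winv.
exists (take c (winv be)); last by rewrite eo.
by rewrite size_take_min size_winv; lia.
Qed.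

Lemma frontier_near : near (5 * K) v (walk v s).
Proof.
have [M [a [b [[Mc ab bM pa pb] [_ hout]]]]] := frontier_word.
(* The bound is [2K + K + 2K]. A cut point is near one end of [s], and then one of the two halves
   again has its ends near both. *)
pose Q i j := near (K + K) v (pt to x0 M i) -> near (K + K) (walk v s) (pt to x0 M j) ->
  near (5 * K) v (walk v s).
suff : Q a b by apply; rewrite ?pa ?pb; apply: near_refl.
have step i j L : (L <= K)%N -> near L (pt to x0 M i) (pt to x0 M j) -> Q i j.
  move=> LK h h1 h2; apply: near_le (near_trans h1 (near_trans h (near_sym h2))).
  by lia.
apply: (chord_induction gP KP Mc ab bM) =>
  [i _|i _ _|i j Y _ ij _ hl hy|i k j ai ik kj jb no h1 h2 h3 h4].
- by apply: (step _ _ 0%N) => //; apply: near_refl.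
- apply: (step _ _ 1%N) => //; exists (factor M i i.+1).
    by rewrite /factor subSnn size_take_min geq_minl.
  by rewrite -pt_factor.
- have [w sw hw] := KP.1 _ _ hy.
  by apply: (step _ _ K) => //; exists w => //; apply: hl.
- have [|h|h] := hout k _ no; first by rewrite (leq_trans ai ik) (leq_trans kj jb).
    exact: h2.
  exact: h1.
Qed.

End Frontier.

(** Cut points are reached from [v] by words of length [5K + 2K]: across the frontier, then from the
    end of [s]. One more letter tests a step. *)
Definition radius := (7 * K).+1.

(* The finite information on the surroundings of a vertex that determines the type
   of its end. *)
Definition agree v v' :=
  [/\ forall w1 Y w2, (size w1 <= radius)%N -> (size w2 <= radius)%N ->
        links to [:: inl Y : nonterminal g + S] (walk v w1) (walk v w2) <->
        links to [:: inl Y : nonterminal g + S] (walk v' w1) (walk v' w2),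
      forall w1 w2, (size w1 <= radius)%N -> (size w2 <= radius)%N ->
        walk v w1 = walk v w2 <-> walk v' w1 = walk v' w2 &
      forall w1 w2, (size w1 <= radius)%N -> (size w2 <= radius)%N ->
        (lev (walk v w1) <= lev (walk v w2))%N = (lev (walk v' w1) <= lev (walk v' w2))%N].

Lemma agree_sym v v' : agree v v' -> agree v' v.
Proof.
move=> [h1 h2 h3]; split=> *; last by rewrite h3.
  by symmetry; apply: h1.
by symmetry; apply: h2.
Qed.

Lemma agree_finite : exists (Q : finType) (c : X -> Q),
  forall v v', c v = c v' -> agree v v'.
Proof.
pose B := radius.-bseq S.
pose c1 v := [set u : B * nonterminal g * B |
  `[< links to [:: inl u.1.2 : nonterminal g + S] (walk v u.1.1) (walk v u.2) >]]%SET.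
pose c2 v := [set u : B * B | `[< walk v u.1 = walk v u.2 >]]%SET.
pose c3 v := [set u : B * B | (lev (walk v u.1) <= lev (walk v u.2))%N]%SET.
exists ({set B * nonterminal g * B} * {set B * B} * {set B * B})%type.
exists (fun v => (c1 v, c2 v, c3 v)) => v v' [/setP e1 /setP e2 /setP e3].
split=> [w1 Y w2 l1 l2|w1 w2 l1 l2|w1 w2 l1 l2].
- by have := e1 (Bseq l1, Y, Bseq l2); rewrite !inE /= => e;
    split=> /asboolP; [rewrite e|rewrite -e] => /asboolP.
- by have := e2 (Bseq l1, Bseq l2); rewrite !inE /= => e;
    split=> /asboolP; [rewrite e|rewrite -e] => /asboolP.
- by have := e3 (Bseq l1, Bseq l2); rewrite !inE.
Qed.

(** Chord induction again: the ends of a chord are reached from [v] by short words, [agree] copies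
    the chord to [v'], and there the factor it spans joins the ends of the same short words. *)
Lemma transfer v v' s w : root v = x0 -> agree v v' -> stays (lev v) v s ->
  lev (walk v s) = lev v -> (size w <= 5 * K)%N -> walk v s = walk v w ->
  walk v' s = walk v' w.
Proof.
move=> rv [ag1 ag2 _] sv lvs sw ew.
have [M [a [b [[Mc ab bM pa pb] [fs hout]]]]] := frontier_word rv sv lvs.
pose Q i j := forall w1 w2, (size w1 <= 7 * K)%N -> (size w2 <= 7 * K)%N ->
  walk v w1 = pt to x0 M i -> walk v w2 = pt to x0 M j ->
  walk v' (w1 ++ factor M i j) = walk v' w2.
suff h : Q a b.
  by have := h [::] w; rewrite walk_nil pa pb fs; apply=> //; lia.
apply: (chord_induction gP KP Mc ab bM) =>
  [i _|i _ _|i j Y _ ij _ hl hy|i k j ai ik kj jb no h1 h2];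
  move=> w1 w2 l1 l2 e1 e2.
- rewrite /factor subnn take0 cats0; apply/ag2; rewrite ?/radius; try lia.
  by rewrite e1.
- have l3 : (size (w1 ++ factor M i i.+1) <= radius)%N.
    by rewrite size_cat /factor subSnn size_take_min /radius; lia.
  apply/ag2 => //; first by rewrite /radius; lia.
  by rewrite walk_cat e1 -pt_factor.
- rewrite walk_cat; have := (ag1 w1 Y w2 (leqW l1) (leqW l2)).1.
  by rewrite e1 e2 => /(_ hl); apply.
- rewrite (factor_cat M ik kj) catA walk_cat.
  (* The cut point is near [v], or near [walk v s], which [w] reaches. *)
  have [w3 l3 e3] : exists2 w3, (size w3 <= 7 * K)%N & walk v w3 = pt to x0 M k.
    have [|[w3 l3 e3]|[w3 l3 e3]] := hout k _ no.
    + by rewrite (leq_trans ai ik) (leq_trans kj jb).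
    + by exists w3 => //; lia.
    + by exists (w ++ w3); [rewrite size_cat; lia | rewrite walk_cat -ew].
  by rewrite (h1 w1 w3) // -walk_cat; apply: h2.
Qed.

(** A first step leaving the end at [v'] would start on its frontier, at a point reached by a short
    word. Transferred to [v], this word reaches [walk v s], and comparing levels shows that the step
    would leave the end there too. *)
Lemma agree_stays v v' s : root v = x0 -> root v' = x0 -> agree v v' ->
  stays (lev v) v s -> stays (lev v') v' s.
Proof.
move=> rv rv' ag; elim/last_ind: s => [//|s a ih].
rewrite -cats1 => /stays_cat[hs [_ hsa]]; have hs' := ih hs.
apply/stays_cat; split=> //=; split; first exact: stays_end hs'.
split=> //; rewrite leqNgt; apply/negP => lt.
have lvs' : lev (walk v' s) = lev v'.
  have := stays_end hs'; have [_] := lev_act (walk v' s) a; lia.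
have [w sw ew] := frontier_near rv' hs' lvs'.
have eva : walk v s = walk v w.
  by apply: (transfer rv' (agree_sym ag) hs' lvs') => //.
have [_ _ /(_ [::] (w ++ [:: a]))] := ag.
rewrite /radius size_cat !walk_cat !walk1 !walk_nil => e.
have h1 : (lev v <= lev (to (walk v w) (gen_eval a)))%N.
  by rewrite -eva; case: hsa.
by move: lt; rewrite -ew ltnNge -e ?h1 //=; lia.
Qed.

(** A descent [t] from [walk v s] to level [lev v] leads at [v'] to level at most [lev v'], so the
    length of [t] bounds the relative level of [walk v' s]. *)
Lemma agree_lev v v' s : root v = x0 -> root v' = x0 -> agree v v' ->
  stays (lev v) v s -> (lev (walk v' s) + lev v <= lev (walk v s) + lev v')%N.
Proof.
move=> rv rv' ag hs; have [t [st ht lt]] := descend (stays_end hs).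
have hst : stays (lev v) v (s ++ t) by apply/stays_cat.
rewrite -walk_cat in lt.
have [w sw ew] := frontier_near rv hst lt.
have ew' := transfer rv ag hst lt sw (esym ew).
have [_ _ e] := ag.
have := e [::] w; have := e w [::]; rewrite ew lt -ew' !walk_nil /radius leqnn => e1 e2.
have h1 : (lev (walk v' (s ++ t)) <= lev v')%N by rewrite -e1 //; lia.
have : near (size t) (walk v' (s ++ t)) (walk v' s).
  by apply: near_sym; exists t => //; rewrite walk_cat.
by move=> /lev_near; have := stays_end hs; lia.
Qed.

Lemma agree_eq v v' s t : root v = x0 -> agree v v' ->
  stays (lev v) v s -> stays (lev v) v t -> walk v s = walk v t ->
  walk v' s = walk v' t.
Proof.
move=> rv ag hs ht e; apply: (@walk_inj _ S _ to (winv t)); rewrite walkK -walk_cat.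
rewrite -[RHS](walk_nil S to); apply: (transfer rv ag) => //.
- by apply/stays_cat; rewrite e; split=> //; apply: stays_winv.
- by rewrite walk_cat e walkK.
- by rewrite walk_cat e walkK walk_nil.
Qed.

Lemma agree_sim v v' : root v = x0 -> root v' = x0 -> agree v v' -> sim v v'.
Proof.
move=> rv rv' ag; have ag' := agree_sym ag.
move=> s; have h1 := agree_stays rv rv' ag; have h2 := agree_stays rv' rv ag'.
split=> [|hs|t hs ht].
- by split; [apply: h1|apply: h2].
- have := agree_lev rv rv' ag hs; have := agree_lev rv' rv ag' (h1 _ hs); lia.
- split; first exact: agree_eq.
  by apply: agree_eq => //; apply: h1.
Qed.

End Orbit.

(** * Uniform bounds over all orbits *)

Hypothesis context_free : forall i,
  context_free_language [set w : seq S | walk (r i) w = r i].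

Lemma grammar_of_root i : exists g : cfg S, forall w,
  walk (r i) w = r i <-> yields [:: inl (start g)] w.
Proof.
have [g eg] := context_free i; exists g => w.
have := congr1 (fun L : set _ => L w) eg; rewrite /= => e.
by rewrite -cfg_languageE -e.
Qed.

Lemma frontier_finite : exists D, forall v s, stays (lev v) v s ->
  lev (walk v s) = lev v -> near D v (walk v s).
Proof.
have /choice[D DP] : forall i, exists D, forall v s, root v = r i ->
    stays (lev v) v s -> lev (walk v s) = lev v -> near D v (walk v s).
  move=> i; have [g gP] := grammar_of_root i; have [K K0 KP] := short_yields g.
  by exists (5 * K)%N => v s rv hs ls; apply: (frontier_near gP K0 KP rv hs ls).
exists (\max_i D i) => v s hs ls; apply: near_le (DP (orbit_index v) v s _ hs ls) => //.
exact: leq_bigmax.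
Qed.

(** Colours are tagged by the orbit index, as [agree] compares vertices with the same root. *)
Lemma sim_finite : exists (Q : finType) (c : X -> Q), forall v v', c v = c v' -> sim v v'.
Proof.
have /choice[Qc QcP] : forall i, exists Qc : {Q : finType & X -> Q}, forall v v',
    root v = r i -> root v' = r i -> projT2 Qc v = projT2 Qc v' -> sim v v'.
  move=> i; have [g gP] := grammar_of_root i.
  have [K K0 KP] := short_yields g.
  have [Q [c cP]] := agree_finite g K.
  by exists (existT _ Q c) => v v' rv rv' /cP ag; exact: (agree_sim gP K0 KP rv rv' ag).
exists {i : 'I_n & projT1 (Qc i)}.
exists (fun v => Tagged (fun i => projT1 (Qc i)) (projT2 (Qc (orbit_index v)) v)) => v v' e.
have ei : orbit_index v = orbit_index v' by apply: (congr1 tag e).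
apply: (QcP (orbit_index v)) => //; first by rewrite /root -ei.
by rewrite -ei in e; apply: eq_from_Tagged e.
Qed.

End Levels.

(** * Encoding vertices by stacks *)

Section Encoding.
Variables (G : groupType) (S : generating_system G) (X : Type).
Variables (to : right_action G X) (n : nat) (r : 'I_n -> X).
Hypothesis r_cover : forall x, exists i, orbit_set to (r i) x.
Local Notation walk := (@walk G S X to).
Local Notation near := (@near G S X to).
Local Notation lev := (@lev G S X to n r r_cover).
Local Notation stays := (@stays G S X to n r r_cover).
Local Notation sim := (@sim G S X to n r r_cover).
Local Notation root := (root r_cover).

Lemma sim_refl x : sim x x.
Proof. by move=> s; split. Qed.

Lemma sim_sym x y : sim x y -> sim y x.
Proof.
move=> h s; have [e1 l1 q1] := h s; split=> [|/e1/l1 //|t hs ht].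
  by symmetry.
by symmetry; apply: q1; [apply/e1 | have [e2 _ _] := h t; apply/e2].
Qed.

Lemma sim_trans x y z : sim x y -> sim y z -> sim x z.
Proof.
move=> h h' s; have [e1 l1 q1] := h s; have [e2 l2 q2] := h' s; split.
- by rewrite e1.
- by move=> hs; have := l1 hs; have := l2 (e1.1 hs); lia.
- move=> t hs ht; rewrite q1 //; apply: q2; first exact/e1.
  by have [e3 _ _] := h t; apply/e3.
Qed.

Lemma sim_lev x y s : sim x y -> stays (lev x) x s ->
  (lev (walk x s) + lev y = lev (walk y s) + lev x)%N.
Proof. by move=> h; have [_] := h s. Qed.

Lemma sim_stays x y s : sim x y -> stays (lev x) x s -> stays (lev y) y s.
Proof. by move=> h; have [[]] := h s. Qed.

Lemma sim_eq x y s t : sim x y -> stays (lev x) x s -> stays (lev x) x t ->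
  walk x s = walk x t -> walk y s = walk y t.
Proof. by move=> h hs ht; have [_ _ /(_ t hs ht)[]] := h s. Qed.

Lemma sim_stays_above k x y s u : sim x y -> stays (lev x) x s ->
  stays (lev x + k) (walk x s) u -> stays (lev y + k) (walk y s) u.
Proof.
move=> h; elim: u s => [|a u ih] s hs /= [lk hu]; have := sim_lev h hs => e.
  by split=> //; lia.
split; first by lia.
have hsa : stays (lev x) x (s ++ [:: a]).
  apply/stays_cat; split=> //=; split; first by lia.
  by split=> //; have := stays_start hu; lia.
by have := ih _ hsa; rewrite !walk_cat !walk1; apply.
Qed.

(** The end at [walk x s] lies inside the end at [x], and the isomorphism restricts to it. *)
Lemma sim_walk x y s : sim x y -> stays (lev x) x s -> sim (walk x s) (walk y s).
Proof.
move=> h hs; have hs' := sim_stays h hs; have e := sim_lev h hs.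
have hl := stays_end hs; have hl' := stays_end hs'.
have up z s' u : stays (lev z) z s' -> stays (lev (walk z s')) (walk z s') u ->
    stays (lev z) z (s' ++ u).
  move=> h1 h2; apply/stays_cat; split=> //.
  by apply: stays_le h2; apply: stays_end h1.
have st z z' u : sim z z' -> stays (lev z) z s ->
    stays (lev (walk z s)) (walk z s) u -> stays (lev (walk z' s)) (walk z' s) u.
  move=> hz hzs hu; have ez := sim_lev hz hzs.
  have l1 := stays_end hzs; have l2 := stays_end (sim_stays hz hzs).
  have := @sim_stays_above (lev (walk z s) - lev z) z z' s u hz hzs.
  by rewrite subnKC // => /(_ hu); congr stays; lia.
move=> t; split=> [|ht|t' ht ht'].
- by split; apply: st => //; apply: sim_sym.
- by have := sim_lev h (up _ _ _ hs ht); rewrite !walk_cat; lia.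
rewrite -!walk_cat; split; apply: sim_eq => //; try exact: up.
- exact: sim_sym.
- by apply: up => //; apply: st ht.
- by apply: up => //; apply: st ht'.
Qed.

(** * Components above a level, and canonical words inside them *)

Definition conn m u v := exists2 t, stays m u t & walk u t = v.

Lemma conn_sym m u v : conn m u v -> conn m v u.
Proof.
by move=> [t ht <-]; exists (winv t); [apply: stays_winv | apply: walkK].
Qed.

Lemma conn_trans m u v w : conn m u v -> conn m v w -> conn m u w.
Proof.
move=> [t ht <-] [s hs <-]; exists (t ++ s); rewrite ?walk_cat //.
by apply/stays_cat.
Qed.

Lemma conn_le m m' u v : (m' <= m)%N -> conn m u v -> conn m' u v.
Proof. by move=> h [t ht <-]; exists t => //; apply: stays_le ht. Qed.

Lemma conn_lev m u v : conn m u v -> (m <= lev u)%N.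
Proof. by move=> [t ht _]; exact: stays_start ht. Qed.

Lemma conn_act m u (a : S) : (m <= lev u)%N -> (m <= lev (to u (gen_eval a)))%N ->
  conn m u (to u (gen_eval a)).
Proof. by move=> h1 h2; exists [:: a]; rewrite ?walk1. Qed.

(** [xget] takes equal values on equal sets, so corresponding vertices of isomorphic ends get the
    same word; [child] relies on this as well. *)
Definition pos x v : seq S := xget [::] [set s | stays (lev x) x s /\ walk x s = v].

Definition child x v : seq S := xget [::] [set s |
  [/\ stays (lev x) x s, lev (walk x s) = (lev x).+1 & conn (lev x).+1 (walk x s) v]].

Lemma posP x v : conn (lev x) x v -> stays (lev x) x (pos x v) /\ walk x (pos x v) = v.
Proof.
move=> [t ht e].
exact: (@xgetPex _ [::] [set s | stays (lev x) x s /\ walk x s = v] (ex_intro _ t (conj ht e))).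
Qed.

Lemma childP x v : conn (lev x) x v -> (lev x < lev v)%N ->
  [/\ stays (lev x) x (child x v), lev (walk x (child x v)) = (lev x).+1 &
      conn (lev x).+1 (walk x (child x v)) v].
Proof.
move=> [t ht e] lv; apply: (@xgetPex _ [::] [set s | [/\ stays (lev x) x s,
  lev (walk x s) = (lev x).+1 & conn (lev x).+1 (walk x s) v]]).
have [t' [_ ht' lt']] := descend lv; exists (t ++ t') => /=.
rewrite walk_cat e lt'; split=> //.
  by apply/stays_cat; rewrite e; split=> //; apply: stays_le ht'.
by exists (winv t'); [apply: stays_winv | apply: walkK].
Qed.

Lemma pos_sim x y t : sim x y -> stays (lev x) x t ->
  pos x (walk x t) = pos y (walk y t).
Proof.
move=> h ht; congr xget; apply/seteqP; split=> s /= [hs e]; split.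
- exact: sim_stays h hs.
- exact: sim_eq e.
- exact: sim_stays (sim_sym h) hs.
- by apply: sim_eq e => //; [exact: sim_sym | exact: sim_stays ht].
Qed.

Lemma child_sim_sub x y t s : sim x y -> stays (lev x) x t ->
  [/\ stays (lev x) x s, lev (walk x s) = (lev x).+1 &
    conn (lev x).+1 (walk x s) (walk x t)] ->
  [/\ stays (lev y) y s, lev (walk y s) = (lev y).+1 &
    conn (lev y).+1 (walk y s) (walk y t)].
Proof.
move=> h ht [hs ls [u hu e]]; split; first exact: sim_stays hs.
  by have := sim_lev h hs; lia.
exists u; first by have := @sim_stays_above 1 x y s u h hs; rewrite !addn1; apply.
rewrite -walk_cat; apply: (sim_eq h) => //; last by rewrite walk_cat.
by apply/stays_cat; split=> //; apply: stays_le hu.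
Qed.

Lemma child_sim x y t : sim x y -> stays (lev x) x t ->
  child x (walk x t) = child y (walk y t).
Proof.
move=> h ht; congr xget; apply/seteqP; split=> s /=; apply: child_sim_sub => //.
  exact: sim_sym.
exact: sim_stays ht.
Qed.

Lemma child_conn x u v : conn (lev x).+1 u v -> child x u = child x v.
Proof.
move=> h; congr xget; apply/seteqP; split=> s /= [h1 h2 h3]; split=> //.
  exact: conn_trans h3 h.
exact: conn_trans h3 (conn_sym h).
Qed.

Variables (Q : finType) (c : X -> Q).
Hypothesis cP : forall x y, c x = c y -> sim x y.

(** The colouring [c] may be finer than [sim]; the set of all colours of a class identifies exactly
    that class. *)
Definition cls x : {set Q} := [set q | `[< exists2 u, sim x u & c u = q >]]%SET.

Lemma clsP x y : cls x = cls y <-> sim x y.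
Proof.
split=> [/setP/(_ (c x))|h].
  rewrite !inE => e; have : `[< exists2 u, sim x u & c u = c x >].
    by apply/asboolP; exists x => //; apply: sim_refl.
  by rewrite e => /asboolP[u hu /cP hx]; apply: sim_trans (sim_sym hx) (sim_sym hu).
apply/setP => q; rewrite !inE; apply: asbool_equiv_eq; split=> -[u hu <-];
  exists u => //; [apply: sim_trans hu; exact: sim_sym | exact: sim_trans hu].
Qed.

(* [mark m v] is a distinguished vertex of level [m] in the component of
   [lev >= m] containing [v]; the step from [mark m v] to [mark m.+1 v] is chosen
   in a set of words that only depends on the [sim]-class of [mark m v]. *)
Fixpoint mark m v := if m is m'.+1 then walk (mark m' v) (child (mark m' v) v) else root v.

Local Notation symbol := ('I_n + {set Q} * seq S)%type.

Fixpoint stack m v : seq symbol :=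
  if m is m'.+1 then inr (cls (mark m' v), child (mark m' v) v) :: stack m' v
  else [:: inl (orbit_index r_cover v)].

(** The top symbol locates [v] in the deepest end containing it; the symbols below describe the
    chain of ends down to the orbit. *)
Definition encode v : seq symbol :=
  inr (cls (mark (lev v) v), pos (mark (lev v) v) v) :: stack (lev v) v.

Lemma stays0 x s : stays 0 x s.
Proof. by elim: s x => [|a s ih] x. Qed.

Lemma markP m v : (m <= lev v)%N -> lev (mark m v) = m /\ conn m (mark m v) v.
Proof.
elim: m => [|m ih] hm.
  split; first exact: lev_root.
  by have [w hw] := root_walk_ex S r_cover v; exists w => //; apply: stays0.
have [lm cm] := ih (ltnW hm); rewrite -{1}lm in cm.
have lt : (lev (mark m v) < lev v)%N by rewrite lm.
by have [_ l2 c2] := childP cm lt; rewrite lm in l2 c2.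
Qed.

Lemma mark_conn m u v k : conn m u v -> (k <= m)%N ->
  mark k u = mark k v /\ stack k u = stack k v.
Proof.
move=> cuv; elim: k => [|k ih] km.
  have [t _ <-] := cuv; rewrite /= /root orbit_index_walk.
  by split.
have [em es] := ih (ltnW km).
have [lk _] : lev (mark k v) = k /\ conn k (mark k v) v.
  by apply: markP; have := conn_lev (conn_sym cuv); lia.
have ec : child (mark k v) u = child (mark k v) v.
  by apply: child_conn; rewrite lk; apply: conn_le cuv.
by rewrite /= em es ec.
Qed.

(** A symbol [inl _] occurs only at the bottom. *)
Lemma stack_prefix m k u v rho : stack m u = stack k v ++ rho -> m = k /\ rho = [::].
Proof.
elim: k m => [|k ih] [|m] //=; first by case.
by case=> _ _ /ih[-> ->].
Qed.

Lemma stack_mark m u v : stack m u = stack m v -> mark m u = mark m v.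
Proof.
elim: m => [|m ih] /=; first by rewrite /root => -[->].
by case=> _ -> /ih ->.
Qed.

Lemma encode_prefix u v rho : encode u = encode v ++ rho -> u = v.
Proof.
case=> _ ep es; have [el er] := stack_prefix es.
move: es; rewrite er cats0 el => /stack_mark em; rewrite el em in ep.
have [|lu cu] := @markP (lev v) u; first by rewrite el.
have [//|lv cv] := @markP (lev v) v.
rewrite -{1}lu em in cu; rewrite -{1}lv in cv.
have [_ e1] := posP cu; have [_ e2] := posP cv.
by rewrite -e2 -ep e1.
Qed.

(** * Finiteness of the alphabet, and the effect of a generator on encodings *)

Hypothesis frontier : exists D, forall v s, stays (lev v) v s ->
  lev (walk v s) = lev v -> near D v (walk v s).

Definition words_bounded B x := forall t, stays (lev x) x t ->
  (lev (walk x t) = lev x -> (size (pos x (walk x t)) <= B)%N) /\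
  ((lev x < lev (walk x t))%N -> (size (child x (walk x t)) <= B)%N).

(** Frontier vertices lie within [D] of [x], and a child is entered one level higher, within
    [D + 1]; so only finitely many words arise. *)
Lemma words_bounded_ex x : exists B, words_bounded B x.
Proof.
have [D hD] := frontier.
pose F (w : D.+1.-bseq S) := maxn (size (pos x (walk x w))) (size (child x (walk x w))).
exists (\max_w F w) => t ht.
have bound y : near D.+1 x y -> (maxn (size (pos x y)) (size (child x y)) <= \max_w F w)%N.
  by move=> [w sw <-]; apply: (@leq_bigmax _ F (Bseq sw)).
split=> lt.
  have := bound _ (near_le (leqnSn D) (hD _ _ ht lt)); lia.
have [|h1 h2 h3] := @childP x (walk x t) _ lt; first by exists t.
have [a ha] := lev_descend h2.
have hsa : stays (lev x) x (child x (walk x t) ++ [:: a]).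
  apply/stays_cat; split=> //=; rewrite h2 ha; split; first by lia.
  by split.
have nu : near (D + 1) x (walk x (child x (walk x t))).
  apply: (@near_trans _ _ _ _ _ _ _ (walk x (child x (walk x t) ++ [:: a]))).
    by apply: hD => //; rewrite walk_cat walk1.
  by apply: near_sym; exists [:: a]; rewrite // walk_cat.
rewrite addn1 in nu; have := bound _ nu.
by rewrite (child_conn h3); lia.
Qed.

Lemma words_bounded_sim B x y : sim x y -> words_bounded B x -> words_bounded B y.
Proof.
move=> h hB t ht; have h' := sim_sym h; have ht' := sim_stays h' ht.
have e := sim_lev h ht'; have [b1 b2] := hB t ht'.
rewrite (pos_sim h' ht) (child_sim h' ht).
by split=> l; [apply: b1 | apply: b2]; lia.
Qed.

Lemma words_bounded_all : exists B, forall x, words_bounded B x.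
Proof.
have /choice[B BP] : forall q : {set Q}, exists B, forall x, cls x = q -> words_bounded B x.
  move=> q; have [[x0 e0]|no] := pselect (exists x, cls x = q).
    have [B hB] := words_bounded_ex x0; exists B => x ex.
    by apply: words_bounded_sim hB; apply/clsP; rewrite e0.
  by exists 0%N => x ex; case: no; exists x.
exists (\max_q B q) => x t ht; have [b1 b2] := BP _ _ erefl t ht.
have le : (B (cls x) <= \max_q B q)%N by apply: leq_bigmax.
by split=> l; apply: leq_trans le; [apply: b1 | apply: b2].
Qed.

Lemma encode_symbols : exists l : seq symbol, forall v, all (mem l) (encode v).
Proof.
have [B hB] := words_bounded_all.
pose l : seq symbol := map inl (enum 'I_n) ++
  map inr [seq (q, bseqval w) | q <- enum {set Q}, w <- enum {: B.-bseq S}].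
have linr q w : (size w <= B)%N -> inr (q, w) \in l.
  move=> sw; rewrite mem_cat; apply/orP; right; apply/map_f/allpairsP.
  by exists (q, Bseq sw); split=> //; rewrite mem_enum.
exists l => v; apply/andP; split.
  have [//|lm [t ht e]] := @markP (lev v) v; apply: linr.
  rewrite -{1}lm in ht; have [b1 _] := hB _ _ ht.
  by rewrite e in b1; apply: b1; rewrite lm.
suff h m : (m <= lev v)%N -> all (mem l) (stack m v) by apply: h.
elim: m => [_|m ih hm] /=; first by rewrite mem_cat map_f ?mem_enum.
rewrite ih ?andbT; last exact: ltnW.
have [|lm [t ht e]] := @markP m v; first exact: ltnW.
rewrite -{1}lm in ht; have [_ b2] := hB _ _ ht; apply: linr.
by rewrite e in b2; apply: b2; rewrite lm.
Qed.

(** The type and the position in the top symbol decide whether the level rises, stays or falls: a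
    symbol is pushed, the position changes, or a symbol is popped. Popping needs the type of the
    next end, hence two symbols are read. *)
Lemma encode_act (a : S) ga u v rho rho' : size ga = 2 ->
  encode u = ga ++ rho -> encode v = ga ++ rho' -> exists ga',
  encode (to u (gen_eval a)) = ga' ++ rho /\ encode (to v (gen_eval a)) = ga' ++ rho'.
Proof.
case: ga => [|[//|[q p]] [|s2 []]] //= _ [eq ep es] [eq' ep' es'].
set u' := to u _; set v' := to v _.
have [//|lu cu] := @markP (lev u) u; have [//|lv cv] := @markP (lev v) v.
set x := mark _ u in eq ep lu cu; set y := mark _ v in eq' ep' lv cv.
have sxy : sim x y by apply/clsP; rewrite eq eq'.
rewrite -{1}lu in cu; rewrite -{1}lv in cv.
have [hp pu] := posP cu; have [hp' pv] := posP cv; rewrite ep in hp pu; rewrite ep' in hp' pv.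
have eu' : walk x (p ++ [:: a]) = u' by rewrite walk_cat pu walk1.
have ev' : walk y (p ++ [:: a]) = v' by rewrite walk_cat pv walk1.
have st : stays (lev x) x (p ++ [:: a]) <-> (lev u <= lev u')%N.
  rewrite stays_cat pu /= lu; split=> [[_ [_ []]] //|h].
  by rewrite lu in hp; split.
have st' : stays (lev y) y (p ++ [:: a]) <-> (lev v <= lev v')%N.
  rewrite stays_cat pv /= lv; split=> [[_ [_ []]] //|h].
  by rewrite lv in hp'; split.
have stxy : stays (lev x) x (p ++ [:: a]) <-> stays (lev y) y (p ++ [:: a]).
  by have [] := sxy (p ++ [:: a]).
have [l1 l2] : (lev u' <= (lev u).+1)%N /\ (lev u <= (lev u').+1)%N by apply: lev_act.
have [l1' l2'] : (lev v' <= (lev v).+1)%N /\ (lev v <= (lev v').+1)%N by apply: lev_act.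
case: (leqP (lev u) (lev u')) => hu.
  have sa := st.2 hu; have sa' := stxy.1 sa; have hv := st'.1 sa'.
  have := sim_lev sxy sa; rewrite eu' ev' lu lv => el.
  have [mu su] := mark_conn (conn_act (leqnn _) hu) (leqnn _).
  have [mv sv] := mark_conn (conn_act (leqnn _) hv) (leqnn _).
  rewrite -/u' -/x in mu su; rewrite -/v' -/y in mv sv.
  case: (ltngtP (lev u') (lev u)) => [|hu1|hu0]; first by lia.
    have eu : lev u' = (lev u).+1 by lia. have ev : lev v' = (lev v).+1 by lia.
    have ecu : child x u' = child y v' by rewrite -eu' -ev'; apply: child_sim.
    have ltu : (lev x < lev u')%N by rewrite lu.
    have [k1 k2 k3] := childP (ex_intro2 _ _ _ sa eu' : conn (lev x) x u') ltu.
    have sw := sim_walk sxy k1; have [t ht et] := k3.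
    have et' : walk (walk y (child x u')) t = v'.
      rewrite -ev' -walk_cat; apply: (sim_eq sxy) => //.
        by apply/stays_cat; split=> //; apply: stays_le ht.
      by rewrite walk_cat et eu'.
    exists [:: inr (cls (walk x (child x u')), pos (walk x (child x u')) u');
      inr (q, child x u'); s2]; split.
      by rewrite /encode eu /= -mu -su es eq.
    rewrite /encode ev /= -mv -sv es' eq' -ecu.
    rewrite ((clsP _ _).2 sw); rewrite -{1}k2 in ht.
    by have := pos_sim sw ht; rewrite et et' => ->.
  have ev0 : lev v' = lev v by lia.
  exists [:: inr (q, pos x u'); s2]; split.
    by rewrite /encode hu0 -mu -su es eq.
  rewrite /encode ev0 -mv -sv es' eq' -eu' (pos_sim sxy sa) ev'.
  by [].
have hv : (lev v' < lev v)%N by rewrite ltnNge; apply/negP => /st'.2/stxy.2/st.1; lia.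
have eu : lev u = (lev u').+1 by lia. have ev : lev v = (lev v').+1 by lia.
have [mu su] : mark (lev u') u = mark (lev u') u' /\ stack (lev u') u = stack (lev u') u'.
  by apply: mark_conn (conn_act _ _) (leqnn _); rewrite // ltnW.
have [mv sv] : mark (lev v') v = mark (lev v') v' /\ stack (lev v') v = stack (lev v') v'.
  by apply: mark_conn (conn_act _ _) (leqnn _); rewrite // ltnW.
have [|lz cz] := @markP (lev u') u; first exact: ltnW.
have [|lz' cz'] := @markP (lev v') v; first exact: ltnW.
move: es es'; rewrite eu ev /= => -[es2 er] [es2' er'].
have xz : x = walk (mark (lev u') u) (child (mark (lev u') u) u) by rewrite /x eu.
have yz : y = walk (mark (lev v') v) (child (mark (lev v') v) v) by rewrite /y ev.
set z := mark _ u in mu lz cz xz es2; set z' := mark _ v in mv lz' cz' yz es2'.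
move: (es2); rewrite -es2' => -[/clsP szz ec].
rewrite -{1}lz in cz; have [|h1 h2 h3] := childP cz; first by rewrite lz.
(* When the level falls, the new position is computed from [z]: the child word leads to [x], then
   [p] to [u], then [a] to [u']. *)
have hz : stays (lev z) z (child z u ++ p ++ [:: a]).
  apply/stays_cat; split=> //; rewrite -xz; apply/stays_cat; split.
    by apply: stays_le hp; rewrite lu lz ltnW.
  by rewrite pu /= -/u' lz; split; [exact: ltnW | split].
have ez : walk z (child z u ++ p ++ [:: a]) = u' by rewrite walk_cat -xz.
have ez' : walk z' (child z u ++ p ++ [:: a]) = v' by rewrite walk_cat ec -yz.
exists [:: inr (cls z, pos z u')]; split.
  by rewrite /encode -mu -su er.
rewrite /encode -mv -sv er' ((clsP _ _).2 szz) -[in RHS]ez (pos_sim szz hz) ez'.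
by [].
Qed.

End Encoding.

(** * From context-free actions to Thompson's group *)

Lemma CF_TR_embeds (G : groupType) (S : generating_system G) :
  CF_TR S -> embeds G thompsonV.
Proof.
move=> [X [to [fth [[n [r r_cov]] cf]]]].
have r_cover x : exists i, orbit_set to (r i) x.
  have : setT x by []. by rewrite -r_cov => -[i _ hi]; exists i.
have cfl i : context_free_language [set w : seq S | walk to (r i) w = r i].
  by apply: (context_free_graphP S to (r i)).1 => //; exists 1 => //; rewrite act1.
have [Q [c cP]] := sim_finite r_cover cfl.
have [l hl] := encode_symbols cP (frontier_finite r_cover cfl).
apply: (stack_action_embeds fth hl (encode_prefix (r_cover := r_cover) (c := c))).
move=> a; exists 2 => ga sga.
have [[u [rho hu]]|no] := pselect (exists u rho, encode S r_cover c u = ga ++ rho); last first.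
  (* No encoding begins with [ga], so any value will do. *)
  by exists [::] => u rho hu; case: no; exists u, rho.
have [ga' [h1 _]] := encode_act cP a sga hu hu; exists ga' => v rho' hv.
(* [encode_act] treats two vertices at a time; cancelling [rho] at the fixed [u] shows that the new
   prefix does not depend on [v]. *)
have [ga'' [h2 h3]] := encode_act cP a sga hu hv.
rewrite h3; congr (_ ++ _); apply: (@catr_inj _ rho).
by rewrite -h1 -h2.
Qed.

Theorem theoremA (G : groupType) (S : generating_system G) :
  embeds G thompsonV <-> CF_TR S.
Proof. by split; [exact: embeds_CF_TR | exact: CF_TR_embeds]. Qed.
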